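(* For each $i \geq 1$ let $G_i$ be a finite symmetric or alternating group of degree $n_i$ (i.e. $G_i = S_{n_i}$ or $A_{n_i}$), acting primitively on a finite set $\Omega_i$ with $|\Omega_i| \geq 3$. Assume $n_i \to \infty$. Let $d_i$ be the proportion of elements $w \in G_i$ having no fixed point on $\Omega_i$. Then the following are equivalent: (1) $\lim_{i\to\infty} d_i = 1$; (2) there is no fixed positive integer $k$ such that, for infinitely many $i$, $\Omega_i$ is (as a $G_i$-set) the set of $k$-element subsets of $\{1,2,\ldots,n_i\}$ with the natural action; (3) the rank of $G_i$ acting on $\Omega_i$ tends to $\infty$.
   Context: A transitive action of a group $G$ on $\Omega$ is primitive if there is no nontrivial $G$-invariant partition of $\Omega$ (no partition into blocks, other than the trivial ones, which $G$ permutes). The rank of a transitive action of $G$ on $\Omega$ is the number of orbits of $G$ on $\Omega \times \Omega$. *)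

(* Defs.v *)
From mathcomp Require Import all_boot all_order all_algebra all_fingroup all_solvable.

Set Implicit Arguments.
Unset Strict Implicit.
Unset Printing Implicit Defensive.

Local Open Scope group_scope.

Section Actions.

Variables (gT : finGroupType) (T : finType) (to : {action gT &-> T}).

Definition primitive_act : bool := [primitive [set: gT], on [set: T] | to].

Definition derangements : {set gT} := [set w | 'Fix_to[w] == set0].

Definition derangement_proportion (R : numFieldType) : R :=
  (#|derangements|%:R / #|gT|%:R)%R.

Definition pair_act (u : T * T) (w : gT) : T * T := (to u.1 w, to u.2 w).

Fact pair_act1 : pair_act^~ 1 =1 id.
Proof. by case=> x y; rewrite /pair_act !act1. Qed.

Fact pair_actM : forall u, act_morph pair_act u.
Proof. by move=> [x y] a b; rewrite /pair_act !actM. Qed.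

Canonical pair_action := TotalAction pair_act1 pair_actM.

Definition act_rank : nat := #|orbit pair_action [set: gT] @: [set: T * T]|.

End Actions.

(* Isomorphism, as a G-set, with the k-element subsets of {0, ..., n-1};
   sgval is the inclusion of the group type [subg G] into 'S_n, and 'P^* is
   the action of 'S_n on subsets by images. *)
Definition is_ksubset_act (n : nat) (G : {group 'S_n}) (T : finType)
    (to : {action [subg G] &-> T}) (k : nat) : Prop :=
  exists f : T -> {set 'I_n},
    [/\ injective f,
        f @: [set: T] = [set A : {set 'I_n} | #|A| == k]
      & forall (x : T) (w : [subg G]), f (to x w) = ('P^* )%act (f x) (sgval w)].

(* Main.v *)
Require Import Defs.
From mathcomp Require Import all_boot all_order all_algebra all_fingroup all_solvable.
From mathcomp Require Import ring lra zify.

(** (1) implies (3): the number of fixed points has mean 1 and mean square the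
    rank, so by Cauchy-Schwarz a proportion at least 1/rank of the elements are
    not derangements.  (3) implies (2): the orbit of a pair of k-sets is determined
    by the size of the intersection, so the rank on k-sets is at most k + 1.

    (2) implies (1): let M be a point stabiliser, a maximal subgroup of G.  Almost
    every permutation w has a cycle of prime length p, with log n << p <= n - 3,
    such that p divides no other cycle length (Dixon); then a power of w is a
    p-cycle.
    - If M is primitive on n points and contains such a w, Jordan's theorem gives
      |M| >= n!/2, contradicting |Omega| >= 3.
    - If M is transitive with a block of size a, then w must preserve a translate
      of the block, and p <= a <= n/2.
    - If M is intransitive, maximality makes Omega the set of k-subsets for some
      k <= n/2, and k tends to infinity by (2).
    In the last two cases w preserves a set of size k, where k is large and at most
    n/2.  This is unlikely: w has about log k cycles of length at most k, whereas a
    uniform pair (A, w) of a k-set and a permutation preserving it has about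
    2 log k of them, and a permutation preserves one k-set on average. *)

Set Implicit Arguments.
Unset Strict Implicit.
Unset Printing Implicit Defensive.
Import Order.TTheory GRing.Theory Num.Theory.

(** * Cycle statistics of random permutations *)

Section Cycles.
Local Open Scope group_scope.
Variable T : finType.
Implicit Types (A B C X : {set T}) (u v w s : {perm T}).

Lemma porbits_neq0 w X : X \in porbits w -> X != set0.
Proof. by case/imsetP=> x _ ->; apply/set0Pn; exists x; apply: porbit_id. Qed.

Lemma porbits_mem w X x : X \in porbits w -> x \in X -> X = porbit w x.
Proof.
by case/imsetP=> y _ -> yx; apply/eqP; rewrite eq_porbit_mem porbit_sym.
Qed.

Lemma mem_porbits w x : porbit w x \in porbits w.
Proof. exact: imset_f. Qed.

Lemma porbits_im w X : X \in porbits w -> w @: X = X.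
Proof.
case/imsetP=> x _ ->; apply/eqP; rewrite eqEcard card_imset ?leqnn ?andbT //;
  last exact: perm_inj.
apply/subsetP=> _ /imsetP[y /porbitP[i ->] ->].
by rewrite -permM -expgSr mem_porbit.
Qed.

Lemma porbit_sub w B x : w @: B = B -> x \in B -> porbit w x \subset B.
Proof.
move=> wB xB; apply/subsetP=> _ /porbitP[i ->].
elim: i => [|i IH]; first by rewrite perm1.
by rewrite expgSr permM -wB imset_f.
Qed.

Lemma eq_in_porbit u w B x :
  {in B, u =1 w} -> u @: B = B -> x \in B -> porbit u x = porbit w x.
Proof.
move=> uw uB xB.
have E i : (u ^+ i) x = (w ^+ i) x /\ (u ^+ i) x \in B.
  elim: i => [|i [IH1 IH2]]; first by rewrite !perm1.
  rewrite !expgSr !permM -IH1 uw //; split=> //.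
  by rewrite -uw // -uB imset_f.
by apply/setP=> y; apply/porbitP/porbitP=> -[i ->]; exists i; rewrite (E i).1.
Qed.

Definition cyc A w : {set {set T}} := [set X in porbits w | X \subset A].

Lemma cycP A w X : reflect (exists2 x, X = porbit w x & X \subset A) (X \in cyc A w).
Proof.
rewrite inE; apply: (iffP andP) => [[/imsetP[x _ ->] XA]|[x -> XA]]; first by exists x.
by rewrite mem_porbits.
Qed.

Lemma sum_card_cyc A w : w @: A = A -> (\sum_(X in cyc A w) #|X|)%N = #|A|.
Proof.
move=> wA; apply/esym/card_partition; apply/and3P; split.
- apply/eqP/setP=> x; apply/bigcupP/idP=> [[X /cycP[y -> /subsetP sA] /sA]//|xA].
  by exists (porbit w x); rewrite ?porbit_id // inE mem_porbits porbit_sub.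
- apply/trivIsetP=> X Y /cycP[x -> _] /cycP[y -> _]; apply: contraR.
  case/pred0Pn=> z /= /andP[zx zy].
  by rewrite -eq_porbit_mem in zx; rewrite -eq_porbit_mem in zy; rewrite -(eqP zx).
- by apply/negP; rewrite inE => /andP[/porbits_neq0/eqP].
Qed.

Section Product.
Variables (B C : {set T}) (u v : {perm T}).
Hypotheses (dBC : [disjoint B & C]) (uB : perm_on B u) (vC : perm_on C v).

Lemma perm_prodl x : x \in B -> (u * v) x = u x.
Proof.
move=> xB; rewrite permM (out_perm vC) //.
by rewrite (disjointFr dBC) // (perm_closed _ uB).
Qed.

Lemma perm_prodr x : x \in C -> (u * v) x = v x.
Proof. by move=> xC; rewrite permM (out_perm uB) // (disjointFl dBC). Qed.

Lemma im_prodl : (u * v) @: B = B.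
Proof. by rewrite -{2}(im_perm_on uB); apply: eq_in_imset => x /perm_prodl. Qed.

Lemma im_prodr : (u * v) @: C = C.
Proof. by rewrite -{2}(im_perm_on vC); apply: eq_in_imset => x /perm_prodr. Qed.

Lemma porbit_prodl x : x \in B -> porbit (u * v) x = porbit u x.
Proof. exact: eq_in_porbit perm_prodl im_prodl. Qed.

Lemma porbit_prodr x : x \in C -> porbit (u * v) x = porbit v x.
Proof. exact: eq_in_porbit perm_prodr im_prodr. Qed.

Lemma cyc_prod : cyc (B :|: C) (u * v) = cyc B u :|: cyc C v.
Proof.
apply/setP=> X; apply/cycP/setUP=> [[x -> XA]|[]/cycP[x -> XA]].
- have /setUP[xB|xC] := subsetP XA x (porbit_id _ _).
    left; rewrite porbit_prodl // inE mem_porbits porbit_sub //; exact: im_perm_on.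
  right; rewrite porbit_prodr // inE mem_porbits porbit_sub //; exact: im_perm_on.
- exists x; last by apply: (subset_trans XA); apply: subsetUl.
  by rewrite porbit_prodl // (subsetP XA) ?porbit_id.
- exists x; last by apply: (subset_trans XA); apply: subsetUr.
  by rewrite porbit_prodr // (subsetP XA) ?porbit_id.
Qed.

Lemma cyc_disjoint : [disjoint cyc B u & cyc C v].
Proof.
apply/pred0P=> X /=; apply/negP=> /andP[/cycP[x -> XB] /cycP[y E XC]].
have xB := subsetP XB x (porbit_id _ _).
have := subsetP XC x (porbit_id _ _).
by rewrite (disjointFr dBC).
Qed.

Lemma mem_porbits_prodl X : X \subset B -> (X \in porbits (u * v)) = (X \in porbits u).
Proof.
move=> XB; apply/imsetP/imsetP=> -[x _ E]; exists x => //.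
  by rewrite E porbit_prodl // (subsetP XB) // E porbit_id.
by rewrite E porbit_prodl // (subsetP XB) // E porbit_id.
Qed.

End Product.

Lemma cyc_full X u : X \in porbits u -> cyc X u = [set X].
Proof.
move=> Xu; apply/setP=> Y; rewrite !inE; apply/andP/eqP=> [[Yu YX]|->//].
have /set0Pn[y yY] := porbits_neq0 Yu.
by rewrite (porbits_mem Yu yY) (porbits_mem Xu (subsetP YX y yY)).
Qed.

Lemma perm_on_subset A B u : B \subset A -> perm_on B u -> perm_on A u.
Proof. by move=> BA uB; apply: subset_trans uB BA. Qed.

(* The stabiliser of [B] in the symmetric group of [A] is the direct product of
   the symmetric groups of [B] and of [A :\: B]. *)
Lemma sum_stab (R : nmodType) A B (F : {perm T} -> R) : B \subset A ->
  (\sum_(w | perm_on A w && (w @: B == B)) F w =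
   \sum_(u | perm_on B u) \sum_(v | perm_on (A :\: B) v) F (u * v)%g)%R.
Proof.
move=> BA; rewrite pair_big /=.
(* The inverse of [(u, v) |-> u * v]: [u] is the restriction of [w] to [B], and [v] is what
   remains. *)
pose h' w := (restr_perm B w, (restr_perm B w)^-1 * w).
rewrite (reindex_onto (fun p => p.1 * p.2) h') /=; last by move=> w _; rewrite mulKVg.
have dB : [disjoint B & A :\: B] by rewrite -setI_eq0 setIDA setIC -setIDA setDv setI0.
apply: eq_bigl => -[u v] /=; apply/idP/idP.
  case/andP=> /andP[wA /eqP wB] /eqP[Eu Ev].
  have uB : perm_on B u by rewrite -Eu restr_perm_on.
  rewrite uB /=; apply/subsetP=> x; rewrite !inE => /negP vx.
  have NB : u * v \in 'N(B | 'P).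
    by apply/astabsP=> y; rewrite /= apermE -{1}wB mem_imset //; apply: perm_inj.
  have vB y : y \in B -> v y = y.
    move=> yB; have uy : u^-1 y \in B by rewrite (perm_closed _ (perm_onV uB)).
    rewrite -{1}(permKV u y) -permM -(restr_permE NB) // Eu.
    by rewrite permKV.
  have xB : x \notin B by apply/negP=> /vB /eqP.
  rewrite xB /=; apply/negPn/negP=> xA; apply: vx.
  have := out_perm wA xA; rewrite permM (out_perm uB) //.
  by move=> ->.
case/andP=> uB vC.
have wB : (u * v) @: B == B by rewrite (im_prodl dB uB vC).
have NB : u * v \in 'N(B | 'P).
  by apply/astabsP=> y; rewrite /= apermE -{1}(eqP wB) mem_imset //; apply: perm_inj.
rewrite wB andbT perm_onM ?(perm_on_subset BA uB) ?(perm_on_subset _ vC) ?subsetDl //=.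
have E : restr_perm B (u * v) = u.
  apply/permP=> x; have [xB|xB] := boolP (x \in B).
    by rewrite restr_permE // (perm_prodl dB uB vC).
  by rewrite (out_perm uB) // (out_perm (restr_perm_on _ _)).
by rewrite /h' E mulKg.
Qed.

(* Palm formula: summing over a permutation together with one of its cycles [X]
   amounts to choosing [X], a full cycle on [X] and a permutation of the rest. *)
Lemma sum_cyc (R : nmodType) A (F : {set T} -> {perm T} -> R) :
  (\sum_(w | perm_on A w) \sum_(X in cyc A w) F X w =
   \sum_(X : {set T} | (X != set0) && (X \subset A)) \sum_(u | perm_on X u && (X \in porbits u))
      \sum_(v | perm_on (A :\: X) v) F X (u * v)%g)%R.
Proof.
rewrite (exchange_big_dep (fun X : {set T} => (X != set0) && (X \subset A))) /=; last first.
  by move=> w X _; rewrite inE => /andP[/porbits_neq0 -> ->].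
apply: eq_bigr => X /andP[X0 XA].
rewrite big_mkcondr /=.
transitivity (\sum_(w | perm_on A w && (w @: X == X)) if X \in porbits w then F X w else 0)%R.
  rewrite [RHS]big_mkcondr /=; apply: eq_bigr => w _.
  have -> : (X \in cyc A w) = (X \in porbits w) by rewrite inE XA andbT.
  by case: (boolP (X \in porbits w)) => [/porbits_im ->|_]; rewrite ?eqxx ?if_same.
rewrite (sum_stab _ XA) [RHS]big_mkcondr; apply: eq_bigr => u uX /=.
have dX : [disjoint X & A :\: X] by rewrite -setI_eq0 setIDA setIC -setIDA setDv setI0.
have E v : perm_on (A :\: X) v -> (X \in porbits (u * v)) = (X \in porbits u).
  by move=> vC; rewrite (mem_porbits_prodl dX uX vC).
by case: ifP => Xu; [apply: eq_bigr | apply: big1] => v vC; rewrite E // Xu.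
Qed.

Lemma sum_subsets (R : nmodType) A (h : nat -> R) :
  (\sum_(X : {set T} | (X != set0) && (X \subset A)) h #|X| =
   \sum_(1 <= j < #|A|.+1) h j *+ 'C(#|A|, j))%R.
Proof.
set m := #|A|; rewrite big_geq_mkord.
rewrite (partition_big (fun X : {set T} => inord #|X| : 'I_m.+1) (fun j : 'I_m.+1 => 0 < j)%N).
  apply: eq_bigr => j j0; rewrite -(cards_draws A j) -sumr_const.
  apply: eq_big => X; last first.
    case/andP=> /andP[_ XA] /eqP <-; rewrite inordK // ltnS; exact: subset_leq_card.
  rewrite inE andbAC andbC; case: (boolP (X \subset A)) => //= XA.
  rewrite -[inord _ == j]/(nat_of_ord _ == nat_of_ord j) inordK ?ltnS ?subset_leq_card //.
  by case: (#|X| =P j) => E; rewrite ?andbF // andbT -card_gt0 E.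
move=> X /andP[X0 XA]; rewrite inordK ?card_gt0 // ltnS; exact: subset_leq_card.
Qed.

Lemma sum_perm_const (R : nmodType) A (c : R) :
  (\sum_(w | perm_on A w) c = c *+ #|A|`!)%R.
Proof. by rewrite -card_perm -sumr_const; apply: eq_bigl. Qed.

Definition full_cycles X := [set u | perm_on X u & X \in porbits u].

Lemma cardsD_sub A X : X \subset A -> #|A :\: X| = (#|A| - #|X|)%N.
Proof. by move=> XA; rewrite cardsD (setIidPr XA). Qed.

Lemma sum_cyc_const (R : nmodType) A (F : {set T} -> R) :
  (\sum_(w | perm_on A w) \sum_(X in cyc A w) F X =
   \sum_(X : {set T} | (X != set0) && (X \subset A))
      F X *+ (#|full_cycles X| * (#|A| - #|X|)`!))%R.
Proof.
rewrite sum_cyc; apply: eq_bigr => X /andP[_ XA].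
under eq_bigr do rewrite sum_perm_const cardsD_sub //.
rewrite mulnC mulrnA -sumr_const; apply: eq_bigl => u.
by rewrite inE.
Qed.

(* Counting pairs (permutation, cycle) weighted by the length of the cycle in two
   ways gives a recursion. *)
Lemma card_full_cycles A : A != set0 -> #|full_cycles A| = (#|A|.-1)`!.
Proof.
have [m] := ubnP #|A|; elim: m A => // m IH A lm A0.
have := sum_cyc_const A (fun X => #|X|%:R : rat)%R.
under eq_bigr => w wA do rewrite -natr_sum sum_card_cyc ?(im_perm_on wA) //.
rewrite sum_perm_const.
(* The total if every [X] had (|X| - 1)! full cycles: each of the |A| sizes contributes |A|!. By
   induction the terms with [X != A] agree, so the terms at [A] agree too. *)
have := sum_subsets A (fun j => (j`! * (#|A| - j)`!)%:R : rat)%R.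
rewrite (eq_big_nat _ _ (F2 := fun=> #|A|`!%:R%R)); last first.
  by move=> j /andP[_ jA]; rewrite -mulrnA mulnC bin_fact.
rewrite big_const_nat iter_addr_0 subn1 /= => E1.
rewrite -mulrnA mulnC mulrnA -E1.
rewrite (bigD1 A) ?A0 ?subxx //= [in RHS](bigD1 A) ?A0 ?subxx //=.
rewrite (eq_bigr (fun X => (#|X|%:R : rat) *+ (#|full_cycles X| * (#|A| - #|X|)`!)))%R; last first.
  move=> X /andP[/andP[X0 XA] nXA].
  have lX : (#|X| < #|A|)%N.
    rewrite ltn_neqAle subset_leq_card // andbT; apply: contra nXA => /eqP E.
    by rewrite eqEcard XA E leqnn.
  rewrite IH ?(leq_trans lX) // -mulrnA mulnA.
  by rewrite -{1}(prednK (n := #|X|)) ?card_gt0 // factS prednK ?card_gt0.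
move/addIr; rewrite subnn fact0 !muln1 -mulrnA => /eqP; rewrite eqr_nat.
rewrite -{1}(prednK (n := #|A|)) ?card_gt0 // factS prednK ?card_gt0 //.
by rewrite eqn_pmul2l ?card_gt0 // => /eqP.
Qed.

End Cycles.

(** * Moments of cycle counts, invariant k-sets and lone cycles *)

Section Moments.
Variables (T : finType) (R : realFieldType).
Implicit Types (A B X : {set T}) (u v w : {perm T}) (f g : nat -> R).
Local Open Scope group_scope.
Local Open Scope ring_scope.

Definition cycw f A w : R := \sum_(X in cyc A w) f #|X|.

(** The mean of [cycw f] over the permutations of m points: for j <= m these have 1/j cycles of
    length j on average. *)
Definition harm f m : R := \sum_(1 <= j < m.+1) f j / j%:R.

Lemma sum_sets_harm A f :
  \sum_(X : {set T} | (X != finset.set0) && (X \subset A))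
     f #|X| *+ ((#|X|.-1)`! * (#|A| - #|X|)`!) = (#|A|`!)%:R * harm f #|A|.
Proof.
rewrite (sum_subsets A (fun j => f j *+ ((j.-1)`! * (#|A| - j)`!))) /harm mulr_sumr.
apply: eq_big_nat => j /andP[j0 jA]; rewrite -mulrnA -[LHS]mulr_natl.
have Ej : (j`! = j * (j.-1)`!)%N by rewrite -{1}(prednK j0) factS prednK.
rewrite -(bin_fact (jA : j <= #|A|)%N) Ej !natrM.
have jr : j%:R != 0 :> R by rewrite pnatr_eq0 -lt0n.
by field.
Qed.

Lemma disjoint_setD A X : [disjoint X & A :\: X].
Proof. by rewrite -setI_eq0 setIDA setIC -setIDA setDv setI0. Qed.

Lemma cycw_prod f A X u v : X \subset A -> perm_on X u -> perm_on (A :\: X) v ->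
  cycw f A (u * v)%g = cycw f X u + cycw f (A :\: X) v.
Proof.
move=> XA uX vA; have dX := disjoint_setD A X.
have -> : cycw f A (u * v)%g = cycw f (X :|: (A :\: X)) (u * v)%g.
  by rewrite -{1}(setID A X) (setIidPr XA).
rewrite /cycw (cyc_prod dX uX vA) -bigU; last exact: (cyc_disjoint u v dX).
by apply: eq_bigl => Y; rewrite !inE.
Qed.

Lemma mean_cycw f A :
  \sum_(w | perm_on A w) cycw f A w = (#|A|`!)%:R * harm f #|A|.
Proof.
rewrite -sum_sets_harm sum_cyc_const; apply: eq_bigr => X /andP[X0 _].
by rewrite card_full_cycles.
Qed.

(** Given a cycle [X], the rest of the permutation is uniform on [A :\: X], so the other cycles have
    mean [harm g (#|A| - #|X|)]. *)
Lemma second_moment_cycw f g A :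
  \sum_(w | perm_on A w) \sum_(X in cyc A w) f #|X| * (cycw g A w - g #|X|) =
  (#|A|`!)%:R * harm (fun j => f j * harm g (#|A| - j)) #|A|.
Proof.
rewrite -sum_sets_harm sum_cyc; apply: eq_bigr => X /andP[X0 XA].
transitivity (\sum_(u in full_cycles X) \sum_(v | perm_on (A :\: X) v) f #|X| * cycw g (A :\: X) v).
  apply: eq_big => [u|u /andP[uX Xu]]; first by rewrite inE.
  apply: eq_bigr => v vA; rewrite (cycw_prod g XA uX vA).
  by rewrite {1}/cycw (cyc_full Xu) big_set1 addrAC subrr add0r.
rewrite sumr_const card_full_cycles // -mulr_sumr mean_cycw cardsD_sub //.
by rewrite mulnC mulrnA -[f _ * harm _ _ *+ _]mulr_natl mulrCA.
Qed.

Lemma harm_ge0 f m : (forall j, 0 <= f j) -> 0 <= harm f m.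
Proof. by move=> f0; apply: sumr_ge0 => j _; rewrite divr_ge0. Qed.

Lemma harm_mono f m1 m2 : (forall j, 0 <= f j) -> (m1 <= m2)%N -> harm f m1 <= harm f m2.
Proof.
move=> f0 m12; rewrite /harm (@big_cat_nat _ _ _ m1.+1 1 m2.+1) //= lerDl.
by apply: sumr_ge0 => j _; rewrite divr_ge0.
Qed.

(** Enlarging [#|A| - j] to [#|A|] bounds the sum over pairs of distinct cycles by a product of
    means. *)
Lemma second_moment_le f g A : (forall j, 0 <= f j) -> (forall j, 0 <= g j) ->
  \sum_(w | perm_on A w) \sum_(X in cyc A w) f #|X| * (cycw g A w - g #|X|) <=
  (#|A|`!)%:R * (harm f #|A| * harm g #|A|).
Proof.
move=> f0 g0; rewrite second_moment_cycw ler_wpM2l //.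
rewrite /harm mulr_suml ler_sum // => j _.
rewrite -mulrA [harm _ _ / _]mulrC mulrA ler_wpM2l ?divr_ge0 //.
by apply: harm_mono => //; apply: leq_subr.
Qed.

Definition ind (a : pred nat) : nat -> R := fun j => (a j)%:R.

Lemma ind_ge0 a j : 0 <= ind a j. Proof. exact: ler0n. Qed.

(** An indicator equals its square, so pairs of equal cycles contribute exactly the mean, while
    pairs of distinct cycles contribute at most the squared mean. Hence the variance is at most the
    mean. *)
Lemma variance_cycw a A :
  \sum_(w | perm_on A w) (cycw (ind a) A w - harm (ind a) #|A|) ^+ 2 <=
  (#|A|`!)%:R * harm (ind a) #|A|.
Proof.
set f := ind a; set mu := harm f _.
have E w : (cycw f A w - mu) ^+ 2 =
    \sum_(X in cyc A w) f #|X| * (cycw f A w - f #|X|) +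
    ((1 - 2 * mu) * cycw f A w + mu ^+ 2).
  have -> : \sum_(X in cyc A w) f #|X| * (cycw f A w - f #|X|) = cycw f A w ^+ 2 - cycw f A w.
    under eq_bigr => X _ do
      rewrite mulrBr (_ : f #|X| * f #|X| = f #|X|) ?/f /ind -?natrM ?mulnb ?andbb //.
    by rewrite sumrB -mulr_suml -expr2.
  by ring.
under eq_bigr do rewrite E.
rewrite !big_split /= -mulr_sumr mean_cycw sum_perm_const.
apply: (le_trans (lerD (second_moment_le A (ind_ge0 a) (ind_ge0 a)) (lexx _))).
rewrite -/f -/mu -[mu ^+ 2 *+ _]mulr_natl.
by rewrite le_eqVlt; apply/orP; left; apply/eqP; ring.
Qed.

Lemma chebyshev_cycw a A (P : pred {perm T}) t :
  (forall w, P w -> t ^+ 2 <= (cycw (ind a) A w - harm (ind a) #|A|) ^+ 2) ->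
  #|[set w | perm_on A w & P w]|%:R * t ^+ 2 <= (#|A|`!)%:R * harm (ind a) #|A|.
Proof.
move=> HP; apply: le_trans (variance_cycw a A).
rewrite mulr_natl -sumr_const [leRHS](bigID P) /=.
apply: (le_trans (y := \sum_(w | perm_on A w && P w) (cycw (ind a) A w - harm (ind a) #|A|) ^+ 2)).
  rewrite (eq_bigl (fun w => perm_on A w && P w)) => [|w]; last by rewrite inE.
  by apply: ler_sum => w /andP[_ /HP].
by rewrite lerDl; apply: sumr_ge0 => w _; apply: sqr_ge0.
Qed.

Lemma sum_bool_card (I : finType) (P Q : pred I) :
  \sum_(i | P i) (Q i)%:R = #|[set i | P i & Q i]|%:R :> R.
Proof.
rewrite -sumr_const [RHS](eq_bigl (fun i => P i && Q i)) => [|i]; last by rewrite inE.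
by rewrite [RHS]big_mkcondr; apply: eq_bigr => i _; case: (Q i).
Qed.

Definition Hsum m : R := harm (fun=> 1) m.

Lemma harm_ind_le k m : (k <= m)%N -> harm (ind (fun j => j <= k)%N) m = Hsum k.
Proof.
move=> km; rewrite /harm (@big_cat_nat _ _ _ k.+1 1 m.+1) //= [X in _ + X]big_nat.
rewrite [X in _ + X]big1 ?addr0.
  by apply: eq_big_nat => j /andP[_ jk]; rewrite /ind -ltnS jk.
by move=> j /andP[kj _]; rewrite /ind leqNgt kj mul0r.
Qed.

Definition fixes_kset k : {set {perm T}} :=
  [set w : {perm T} | [exists B : {set T}, (#|B| == k) && (w @: B == B)]].

(* A random permutation has about [Hsum k] cycles of length at most [k], whereas a
   random pair (k-set [B], permutation preserving [B]) has about [2 * Hsum k] of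
   them, and the expected number of preserved k-sets is 1. *)
Lemma card_fixes_kset k : (k.*2 <= #|T|)%N ->
  #|fixes_kset k|%:R * Hsum k <= 36 * (#|T|`!)%:R.
Proof.
move=> k2; have [->|k0] := posnP k.
  by rewrite /Hsum /harm big_geq // mulr0 mulr_ge0.
have kT : (k <= #|T|)%N by apply: leq_trans k2; rewrite -addnn leq_addr.
set H := Hsum k; have H0 : 0 < H.
  rewrite /H /Hsum /harm big_ltn //= ltr_wpDr ?divr_gt0 //.
  by apply: sumr_ge0 => j _; rewrite divr_ge0.
pose f := ind (fun j => j <= k)%N.
pose N (A : {set T}) w := cycw f A w.
have cheb (A : {set T}) (P : pred {perm T}) t : (k <= #|A|)%N ->
    (forall w, P w -> t ^+ 2 <= (N A w - H) ^+ 2) ->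
    #|[set w | perm_on A w & P w]|%:R * t ^+ 2 <= (#|A|`!)%:R * H.
  by move=> kA HP; rewrite /H -(harm_ind_le kA); apply: chebyshev_cycw => w; rewrite harm_ind_le //; apply: HP.
(* The threshold 3/2 H lies between the mean H over all permutations and the mean 2 H over those
   preserving a given k-set. *)
pose S1 := [set w | perm_on [set: T] w & 3 / 2 * H <= N [set: T] w].
pose S2 (B : {set T}) := [set w : {perm T} | (w @: B == B) && (N [set: T] w < 3 / 2 * H)].
have sub : fixes_kset k \subset S1 :|: \bigcup_(B : {set T} | #|B| == k) S2 B.
  apply/subsetP=> w; rewrite !inE => /existsP[B /andP[Bk wB]].
  have -> : perm_on [set: T] w by apply/subsetP=> x; rewrite !inE.
  case: leP => //= Nw; apply/bigcupP; exists B => //.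
  by rewrite inE wB Nw.
have b1 : #|S1|%:R * (H / 2) ^+ 2 <= (#|T|`!)%:R * H.
  rewrite -[#|T|]cardsT; apply: cheb => [|w]; first by rewrite cardsT.
  by move=> ?; rewrite lerXn2r ?nnegrE; lra.
have b2 (B : {set T}) : #|B| = k -> #|S2 B|%:R * (H / 4) ^+ 2 <= 2 * ((k`! * (#|T| - k)`!)%N%:R * H).
  move=> Bk; pose C := [set: T] :\: B.
  have cC : #|C| = (#|T| - k)%N by rewrite cardsD_sub ?subsetT // cardsT Bk.
  (* A pair [(u, v)] with fewer than 3/2 H short cycles has fewer than 3/4 H on [B] or on [C]; both
     means are H, because [C] too has at least k points. *)
  pose U := [set u | perm_on B u & N B u < 3 / 4 * H].
  pose V := [set v | perm_on C v & N C v < 3 / 4 * H].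
  have bU : #|U|%:R * (H / 4) ^+ 2 <= (k`!)%:R * H.
    rewrite -Bk; apply: cheb => [|w]; first by rewrite Bk.
    by move=> ?; rewrite -[leRHS]sqrrN lerXn2r ?nnegrE; lra.
  have bV : #|V|%:R * (H / 4) ^+ 2 <= ((#|T| - k)`!)%:R * H.
    rewrite -cC; apply: cheb => [|w]; first by rewrite cC leq_subRL // addnn.
    by move=> ?; rewrite -[leRHS]sqrrN lerXn2r ?nnegrE; lra.
  have : #|S2 B|%:R <= #|U|%:R * ((#|T| - k)`!)%:R + (k`!)%:R * #|V|%:R :> R.
    rewrite -sumr_const (eq_bigl (fun w => (perm_on [set: T] w && (w @: B == B)) && (N [set: T] w < 3 / 2 * H))); last first.
      move=> w; rewrite inE; have -> // : perm_on [set: T] w by apply/subsetP=> x; rewrite !inE.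
    rewrite big_mkcondr sum_stab ?subsetT //.
    pose M : R := \sum_(u | perm_on B u) \sum_(v | perm_on C v)
         ((N B u < 3 / 4 * H)%R%:R + (N C v < 3 / 4 * H)%R%:R).
    apply: (@le_trans _ _ M).
      apply: ler_sum => u uB; apply: ler_sum => v vC.
      rewrite /N (cycw_prod f (subsetT B) uB vC).
      case: ifP => [lt|_]; last by rewrite addr_ge0 ?ler0n.
      case: ltP => h1; first by rewrite lerDl ler0n.
      case: ltP => h2; first by rewrite lerDr ler0n.
      by exfalso; move: lt h1 h2; rewrite /N; lra.
    rewrite /M; under eq_bigr do rewrite big_split /= sum_perm_const cC sum_bool_card.
    rewrite big_split /= sum_perm_const Bk sumrMnl sum_bool_card.
    by rewrite -/U -/V -[#|U|%:R *+ _]mulr_natr -[#|V|%:R *+ _]mulr_natl.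
  move=> bS; rewrite natrM; move: bU bV bS; set q := (H / 4) ^+ 2.
  set x := #|U|%:R; set y := #|V|%:R; set z := #|S2 B|%:R.
  set a := (k`!)%:R; set b := ((_ - _)`!)%:R => bU bV bS.
  have q0 : 0 <= q by apply: sqr_ge0.
  apply: (le_trans (ler_wpM2r q0 bS)); rewrite mulrDl.
  have -> : 2 * (a * b * H) = (a * H) * b + (b * H) * a by ring.
  apply: lerD; first by rewrite mulrAC ler_wpM2r // ler0n.
  by rewrite -[a * y * q]mulrA [leRHS]mulrC ler_wpM2l // ler0n.
have b3 : (\sum_(B : {set T} | #|B| == k) #|S2 B|)%:R * (H / 4) ^+ 2 <= 2 * ((#|T|`!)%:R * H).
  rewrite natr_sum mulr_suml.
  apply: (le_trans (y := \sum_(B : {set T} | #|B| == k) 2 * ((k`! * (#|T| - k)`!)%N%:R * H))).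
    by apply: ler_sum => B /eqP /b2.
  rewrite (eq_bigl (fun B : {set T} => B \in [set B : {set T} | B \subset [set: T] & #|B| == k])); last first.
    by move=> B; rewrite inE subsetT.
  rewrite sumr_const cards_draws cardsT -mulr_natr -(bin_fact kT) !natrM.
  by rewrite le_eqVlt; apply/orP; left; apply/eqP; ring.
have : (#|fixes_kset k| <= #|S1| + \sum_(B : {set T} | #|B| == k) #|S2 B|)%N.
  apply: leq_trans (subset_leq_card sub) _; apply: leq_trans (leq_card_setU _ _) _.
  rewrite leq_add2l; elim/big_rec2: _ => [|B c D _ IH]; first by rewrite cards0.
  by apply: leq_trans (leq_card_setU _ _) _; rewrite leq_add2l.
rewrite -(ler_nat R) natrD; move: b1 b3.
set x := #|S1|%:R; set y := (\sum_(B : {set T} | _) _)%:R; set z := #|_|%:R; set F := (_`!)%:R => b1 b3 bz.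
rewrite !expr2 in b1 b3.
(* 36 = 4 + 32: a deviation of H / 2 costs 4, and deviations of H / 4 in two factors cost 2 times
   16. *)
have b1' : x * H <= 4 * F by rewrite -(ler_pM2r H0); lra.
have b3' : y * H <= 32 * F by rewrite -(ler_pM2r H0); lra.
by apply: (le_trans (ler_wpM2r (ltW H0) bz)); lra.
Qed.

(** Substitute j = p i in the sum. *)
Lemma harm_dvdn f p m : (0 < p)%N ->
  harm (fun j => ind (dvdn p) j * f (j %/ p)%N) m = harm f (m %/ p) / p%:R.
Proof.
move=> p0; elim: m => [|m IH].
  by rewrite div0n /harm !big_geq // mul0r.
rewrite /harm big_nat_recr //= -/(harm _ _) IH divnS // /ind.
case: (boolP (p %| m.+1)%N) => pm; last by rewrite !mul0r addr0.
rewrite add1n /harm [in RHS]big_nat_recr //= [in RHS]mulrDl; congr (_ + _).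
have -> : m.+1%:R = (m %/ p).+1%:R * p%:R :> R.
  by rewrite -natrM; congr (_%:R); rewrite -{1}(divnK pm) divnS // pm.
by rewrite mul1r invfM mulrA.
Qed.

Lemma Hsum_mono m1 m2 : (m1 <= m2)%N -> Hsum m1 <= Hsum m2.
Proof. exact: harm_mono. Qed.

Lemma Hsum_ge0 m : 0 <= Hsum m.
Proof. exact: harm_ge0. Qed.

(** Telescoping, from 1 / j^2 <= 1 / (j - 1) - 1 / j. *)
Lemma sum_inv_sqr m k : (0 < m)%N -> (m <= k)%N ->
  \sum_(m.+1 <= j < k.+1) (j%:R ^+ 2)^-1 <= m%:R^-1 - k%:R^-1 :> R.
Proof.
move=> m0; elim: k => [|k IH]; first by rewrite leqn0 => /eqP E; rewrite E in m0.
rewrite leq_eqVlt => /orP[/eqP<-|mk]; first by rewrite big_geq // subrr.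
rewrite big_nat_recr //=; apply: (le_trans (lerD (IH mk) (lexx _))).
have k0 : 0 < k%:R :> R by rewrite ltr0n; lia.
rewrite -addrA lerD2l -natr1.
rewrite addrC lerBlDr -subr_ge0.
have -> : - (k%:R + 1)^-1 + k%:R^-1 - ((k%:R + 1) ^+ 2)^-1 = (k%:R * (k%:R + 1) ^+ 2)^-1 :> R.
  by field; lra.
by rewrite invr_ge0 mulr_ge0 ?exprn_ge0; lra.
Qed.

(** When [P] selects primes, such a cycle can be isolated: a suitable power of [w] is a cycle on [X]
    and trivial elsewhere. *)
Definition lone_cycle (P : pred nat) : {set {perm T}} :=
  [set w : {perm T} | [exists X in porbits w, P #|X| &&
     [forall Y in porbits w, (Y != X) ==> ~~ (#|X| %| #|Y|)%N]]].

(** Two ways to fail. Having no cycle with length in [P] is unlikely by Chebyshev. Otherwise a cycle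
    of some length p > m comes with another cycle of length divisible by p; the expected number of
    such pairs is at most [Hsum n] / p^2, and these bounds sum to at most [Hsum n] / m. *)
Lemma card_not_lone_cycle (P : pred nat) m : (0 < m)%N ->
  (forall j, P j -> (m < j)%N) -> 0 < harm (ind P) #|T| ->
  #|~: lone_cycle P|%:R <=
    (#|T|`!)%:R * ((harm (ind P) #|T|)^-1 + Hsum #|T| / m%:R).
Proof.
move=> m0 Pm; set S := harm _ _ => S0; set n := #|T|.
have onT w : perm_on [set: T] w by apply/subsetP=> x; rewrite !inE.
pose S1 := [set w | perm_on [set: T] w & cycw (ind P) [set: T] w == 0].
have b1 : #|S1|%:R <= (n`!)%:R * S^-1.
  rewrite ler_pdivlMr // -(ler_pM2r S0) -mulrA -expr2.
  rewrite /n /S -[#|T|]cardsT; apply: chebyshev_cycw => w /eqP ->.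
  by rewrite sub0r sqrrN.
(* Counts the pairs of a cycle of length [p] and another cycle whose length is a multiple of [p]. *)
pose G p w := \sum_(X in cyc [set: T] w)
  ind (pred1 p) #|X| * (cycw (ind (dvdn p)) [set: T] w - ind (dvdn p) #|X|).
have Gterm p w X : X \in cyc [set: T] w ->
    cycw (ind (dvdn p)) [set: T] w - ind (dvdn p) #|X| =
    \sum_(Y in cyc [set: T] w | Y != X) ind (dvdn p) #|Y|.
  by move=> Xw; rewrite /cycw (bigD1 X) //= addrAC subrr add0r.
have Gt0 p w X : X \in cyc [set: T] w ->
    0 <= ind (pred1 p) #|X| * (cycw (ind (dvdn p)) [set: T] w - ind (dvdn p) #|X|).
  by move=> Xw; rewrite Gterm // mulr_ge0 ?ind_ge0 // sumr_ge0 // => Y _; apply: ind_ge0.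
have G0 p w : 0 <= G p w by apply: sumr_ge0 => X; apply: Gt0.
have EG p : (0 < p <= n)%N -> \sum_(w | perm_on [set: T] w) G p w <= (n`!)%:R * (Hsum n / p%:R ^+ 2).
  case/andP=> p0 pn.
  apply: (le_trans (second_moment_le _ (ind_ge0 _) (ind_ge0 _))).
  rewrite cardsT ler_wpM2l //.
  have -> : harm (ind (dvdn p)) n = Hsum (n %/ p) / p%:R.
    by rewrite -harm_dvdn //; apply: eq_bigr => j _; rewrite mulr1.
  have -> : harm (ind (pred1 p)) n = p%:R^-1.
    rewrite /harm (bigD1_seq p) ?mem_index_iota ?iota_uniq ?p0 //= /ind /= eqxx mul1r.
    by rewrite big1 ?addr0 // => j /negPf jp; rewrite jp mul0r.
  rewrite mulrCA expr2 invfM ler_wpM2r ?mulr_ge0 ?invr_ge0 //.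
  by apply: Hsum_mono; apply: leq_div.
pose S2 := [set w : {perm T} | 1 <= \sum_(m.+1 <= p < n.+1) G p w].
have b2 : #|S2|%:R <= (n`!)%:R * (Hsum n / m%:R).
  apply: (@le_trans _ _ (\sum_(w | perm_on [set: T] w) \sum_(m.+1 <= p < n.+1) G p w)).
    rewrite -sumr_const [leRHS](bigID (fun w => w \in S2)) /=.
    rewrite [leLHS](eq_bigl (fun w => perm_on [set: T] w && (w \in S2))); last by move=> w; rewrite onT.
    apply: ler_wpDr; first by apply: sumr_ge0 => w _; apply: sumr_ge0.
    by apply: ler_sum => w /andP[_]; rewrite inE.
  rewrite exchange_big /=.
  apply: (@le_trans _ _ (\sum_(m.+1 <= p < n.+1) (n`!)%:R * (Hsum n / p%:R ^+ 2))).
    by rewrite !big_nat; apply: ler_sum => p /andP[mp pn]; apply: EG; lia.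
  rewrite -mulr_sumr ler_wpM2l // -mulr_sumr ler_wpM2l ?Hsum_ge0 //.
  case: (leqP m n) => mn; last by rewrite big_geq ?invr_ge0 // ltnS ltnW.
  apply: (le_trans (sum_inv_sqr m0 mn)).
  by rewrite gerBl invr_ge0.
have sub : ~: lone_cycle P \subset S1 :|: S2.
  apply/subsetP=> w; rewrite !inE negb_exists => /forallP nl; rewrite onT /=.
  case: eqP => //= /eqP nz.
  have [X Xw PX] : exists2 X, X \in porbits w & P #|X|.
    apply/exists_inP; apply: contraR nz; rewrite negb_exists => /forallP nP.
    apply/eqP; apply: big1 => X; rewrite inE => /andP[Xw _].
    by move: (nP X); rewrite Xw /= /ind => /negPf ->.
  have := nl X; rewrite Xw PX /= negb_forall => /existsP[Y].
  rewrite negb_imply negb_imply negbK => /and3P[Yw YX XY].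
  have cX Z : Z \in porbits w -> Z \in cyc [set: T] w by move=> Zw; rewrite inE Zw subsetT.
  have Xn : #|X| \in index_iota m.+1 n.+1 by rewrite mem_index_iota Pm // ltnS max_card.
  rewrite (bigD1_seq _ Xn (iota_uniq _ _)) /=; apply: ler_wpDr; first by apply: sumr_ge0.
  rewrite /G (bigD1 X) ?cX //=; apply: ler_wpDr.
    by apply: sumr_ge0 => Z /andP[/Gt0].
  rewrite {1}/ind /= eqxx mul1r Gterm ?cX // (bigD1 Y) ?cX //= /ind XY.
  by apply: ler_wpDr => //; apply: sumr_ge0 => Z _; apply: ler0n.
have : (#|~: lone_cycle P| <= #|S1| + #|S2|)%N.
  exact: leq_trans (subset_leq_card sub) (leq_card_setU _ _).
rewrite -(ler_nat R) natrD mulrDr => /le_trans; apply.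
exact: lerD.
Qed.

End Moments.

(** * Jordan groups *)

Section Jordan.
Local Open Scope group_scope.
Variables (T : finType) (G : {group {perm T}}).
Implicit Types (x y z a b c : T) (g h k s : {perm T}) (A B C D : {set T}).

Lemma im_permM g h A : (g * h) @: A = h @: (g @: A).
Proof. by rewrite -imset_comp; apply: eq_imset => x; rewrite /= permM. Qed.

Lemma mem_im_perm g A x : (g x \in g @: A) = (x \in A).
Proof. by rewrite mem_imset //; apply: perm_inj. Qed.

Lemma card_im_perm g A : #|g @: A| = #|A|.
Proof. by rewrite card_imset //; apply: perm_inj. Qed.

Lemma im_permK g A : g^-1 @: (g @: A) = A.
Proof. by rewrite -im_permM mulgV imset_perm1. Qed.

Lemma im_permKV g A : g @: (g^-1 @: A) = A.
Proof. by rewrite -im_permM mulVg imset_perm1. Qed.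

Lemma im_permD g A B : g @: (A :\: B) = g @: A :\: g @: B.
Proof. by apply/setP=> y; rewrite -(permKV g y) !inE !mem_im_perm !inE. Qed.

Lemma im_permI g A B : g @: (A :&: B) = g @: A :&: g @: B.
Proof. by apply: imsetI; apply: in2W; apply: perm_inj. Qed.

Lemma perm_onJ A g h : perm_on A g -> perm_on (h @: A) (g ^ h).
Proof.
move=> gA; apply/subsetP=> x; rewrite inE; apply: contraR => xA.
rewrite -(permKV h x) permJ (out_perm gA) //.
by apply: contra xA => /(imset_f h); rewrite permKV.
Qed.

Definition trans_on A :=
  forall x y, x \in A -> y \in A -> exists2 g, g \in G & perm_on A g /\ g x = y.

Definition blockfree A :=
  forall B, B \subset A -> 1 < #|B| < #|A| ->
  exists2 g, g \in G & [/\ perm_on A g, g @: B != B & g @: B :&: B != set0].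

(* The pointwise stabiliser in [G] of the complement of [A] acts primitively on [A]. *)
Definition jordan A := trans_on A /\ blockfree A.

Lemma trans_on_from A z : z \in A ->
  (forall x, x \in A -> exists2 g, g \in G & perm_on A g /\ g x = z) -> trans_on A.
Proof.
move=> zA H x y /H[g gG [gA gx]] /H[h hG [hA hy]].
exists (g * h^-1); first by rewrite groupM ?groupV.
by rewrite perm_onM ?perm_onV // permM gx -hy permK.
Qed.

(* A translate [g @: A] meeting [A], distinct from it and closest to it: if it left
   [A] at two points, primitivity on [g @: A] would yield a closer one. *)
Lemma jordan_near A : jordan [set: T] -> jordan A -> 1 < #|A| < #|T| ->
  exists2 g, g \in G & #|g @: A :\: A| = 1%N.
Proof.
move=> [_ bfT] [_ bfA] lA.
have [|g0 g0G [_ g0n g0i]] := bfT A (subsetT A); first by rewrite cardsT.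
pose P g := [&& g \in G, g @: A != A & g @: A :&: A != set0].
have P0 : P g0 by rewrite /P g0G g0n g0i.
case: (arg_minnP (fun g => #|g @: A :\: A|) P0) => g /and3P[gG gn gi] gmin.
exists g => //; apply/eqP; rewrite eqn_leq andbC; apply/andP; split.
  rewrite card_gt0; apply: contra gn; rewrite setD_eq0 => sA.
  by rewrite eqEcard sA card_im_perm leqnn.
rewrite leqNgt; apply/negP => lt.
set D := g @: A :\: A in lt.
(* Primitivity on [A], applied to the pullback of [D], gives an [h] supported in [g @: A] such that
   [h @: D] meets [D] but differs from it. *)
pose B := g^-1 @: D.
have BA : B \subset A.
  by rewrite -(im_permK g A); apply: imsetS; apply: subsetDl.
have lB : 1 < #|B| < #|A|.
  rewrite card_im_perm lt /= -[X in _ < X](card_im_perm g) /D.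
  by rewrite -(cardsID A (g @: A)) -[X in X < _]add0n ltn_add2r card_gt0.
have [k kG [kA kn ki]] := bfA B BA lB.
pose h := k ^ g.
have hA : perm_on (g @: A) h by apply: perm_onJ.
have hG : h \in G by rewrite groupJ.
have hD : h @: D = g @: (k @: B).
  by rewrite /h /conjg !im_permM.
have hn : h @: D != D.
  by rewrite hD; apply: contra kn => /eqP E; rewrite /B -{2}E im_permK.
have hi : h @: D :&: D != set0.
  rewrite hD -[X in _ :&: X](im_permKV g) -im_permI -/B.
  by rewrite -card_gt0 card_im_perm card_gt0.
(* A point of [h @: A] outside [A] was moved by [h], so it comes from [A :&: g @: A]; hence it lies
   in [D] and not in [h @: D]. *)
have sub : h @: A :\: A \subset D :\: h @: D.
  apply/subsetP=> _ /setDP[/imsetP[y yA ->] hyA].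
  have yg : y \in g @: A by apply: contraR hyA => /(out_perm hA) ->.
  have yD : y \notin D by rewrite inE yA.
  by rewrite inE mem_im_perm yD /= inE hyA /= -(im_perm_on hA) mem_im_perm.
have ltD : #|h @: A :\: A| < #|D|.
  apply: (leq_ltn_trans (subset_leq_card sub)).
  rewrite -(cardsID (h @: D) D) -[X in X < _]add0n ltn_add2r card_gt0.
  by rewrite setIC.
have hAn : h @: A != A.
  apply: contra hn => /eqP E; rewrite /D im_permD E (im_perm_on hA) eqxx //.
have hAi : h @: A :&: A != set0.
  rewrite -card_gt0 -(ltn_add2r #|h @: A :\: A|) add0n cardsID card_im_perm.
  apply: (ltn_trans ltD); rewrite /D -[X in _ < X](card_im_perm g).
  by rewrite -(cardsID A (g @: A)) -[X in X < _]add0n ltn_add2r card_gt0.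
have := gmin h; rewrite /P hG hAn hAi => /(_ isT).
by rewrite leqNgt ltD.
Qed.

(** The two hypotheses make the action on [z |: A] doubly transitive: with a, b in [B] and c
    outside, move a to z, use [A] to send the image of b to that of c, and move back. The result
    fixes a, so the translate meets [B], and it sends b to c. *)
Lemma blockfree_2trans A z : z \notin A -> trans_on A -> trans_on (z |: A) ->
  blockfree (z |: A).
Proof.
move=> zA tA tA' B BA /andP[B1 BlA].
have [a [b [aB bB ab]]] : exists a b, [/\ a \in B, b \in B & a != b].
  by have/card_gt1P[a [b []]] := B1; exists a, b.
have [c cA cB] : exists2 c, c \in z |: A & c \notin B.
  have : ~~ (z |: A \subset B).
    by apply/negP=> /subset_leq_card; rewrite leqNgt BlA.
  by case/subsetPn=> c ? ?; exists c.
have [g gG [gA ga]] := tA' a z (subsetP BA a aB) (setU11 _ _).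
have inA x : x \in z |: A -> x != a -> g x \in A.
  move=> xA xa; have : g x \in z |: A by rewrite (perm_closed _ gA).
  rewrite !inE => /orP[/eqP E|//].
  by rewrite -ga in E; move/perm_inj: E => E; rewrite E eqxx in xa.
have ca : c != a by apply: contraNneq cB => ->.
have ba : b != a by rewrite eq_sym.
have [k kG [kA kb]] := tA (g b) (g c) (inA b (subsetP BA b bB) ba) (inA c cA ca).
have kz : k z = z by apply: out_perm kA zA.
have kA' : perm_on (z |: A) k by apply: perm_on_subset kA; apply: subsetUr.
pose h := g * k * g^-1.
have ha : h a = a by rewrite !permM ga kz -ga permK.
have hb : h b = c by rewrite !permM kb permK.
exists h; first by rewrite !groupM ?groupV.
split; first by rewrite !perm_onM ?perm_onV.
  by apply: contraNneq cB => <-; rewrite -hb mem_im_perm.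
by apply/set0Pn; exists a; rewrite inE aB -{1}ha mem_im_perm aB.
Qed.

(** A closest translate [g @: A] consists of z and all but one point of [A]. Moving a point of [A]
    into [g @: A], then within [g @: A] to z, gives transitivity on [z |: A]. *)
Lemma jordan_step A : jordan [set: T] -> jordan A -> 1 < #|A| < #|T| ->
  exists2 z, z \notin A & jordan (z |: A).
Proof.
move=> jT jA lA; have [g gG /eqP/cards1P[z E]] := jordan_near jT jA lA.
have /setDP[zg zA] : z \in g @: A :\: A by rewrite E set11.
exists z => //.
have tA := jA.1.
suff t : trans_on (z |: A) by split=> //; apply: blockfree_2trans.
have gA : g @: A \subset z |: A.
  apply/subsetP=> x xg; rewrite !inE; case: (boolP (x \in A)) => xA; rewrite ?orbT //.
  by rewrite orbF -in_set1 -E inE xA xg.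
have [c] : exists c, c \in g @: A :&: A.
  apply/set0Pn; rewrite -card_gt0 -(ltn_add2r #|g @: A :\: A|) cardsID E cards1.
  by rewrite card_im_perm; case/andP: lA.
rewrite inE => /andP[cg cA].
apply: (trans_on_from (setU11 z A)) => x; rewrite !inE => /orP[/eqP->|xA].
  by exists 1 => //; rewrite perm_on1 perm1.
have [k kG [kA kx]] := tA x c xA cA.
case/imsetP: cg kx => c0 c0A -> kx; case/imsetP: zg => z0 z0A Ez.
have [h hG [hA hc]] := tA c0 z0 c0A z0A.
exists (k * h ^ g); first by rewrite groupM // groupJ.
split; last by rewrite permM kx permJ hc -Ez.
apply: perm_onM; first by apply: perm_on_subset kA; apply: subsetUr.
by apply: (perm_on_subset gA); apply: perm_onJ.
Qed.

Definition local_group A := (G :&: perm.Sym A)%G.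

Lemma mem_local_group A g : (g \in local_group A) = (g \in G) && perm_on A g.
Proof. by rewrite inE [in X in _ && X]inE. Qed.

Lemma card_local_group A z : trans_on A -> z \in A ->
  #|local_group A| = (#|A| * #|'C_(local_group A)[z | 'P]|)%N.
Proof.
move=> tA zA; rewrite -(card_orbit_stab 'P (local_group A) z).
suff -> : orbit 'P (local_group A) z = A by [].
apply/setP=> x; apply/orbitP/idP=> [[g]|xA].
  by rewrite mem_local_group => /andP[_ gA] <-; rewrite /= apermE (perm_closed _ gA).
by have [g gG [gA gz]] := tA z x zA xA; exists g; rewrite ?mem_local_group ?gG //.
Qed.

Lemma local_group_step A z : z \notin A -> trans_on (z |: A) ->
  (#|A|.+1 * #|local_group A| <= #|local_group (z |: A)|)%N.
Proof.
move=> zA t; rewrite (card_local_group t (setU11 z A)) cardsU1 zA add1n leq_mul2l /=.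
apply: subset_leq_card; apply/subsetP=> g; rewrite mem_local_group => /andP[gG gA].
rewrite inE mem_local_group gG (perm_on_subset _ gA) ?subsetUr //=.
by apply/astab1P; rewrite /= apermE (out_perm gA).
Qed.

(** Points are added to [A] one at a time: each step multiplies the order of the local group by at
    least the factor by which the factorial grows. *)
Lemma jordan_card A : jordan [set: T] -> jordan A -> 1 < #|A| ->
  (#|A|`! <= 2 * #|local_group A|)%N -> (#|T|`! <= 2 * #|G|)%N.
Proof.
move=> jT; move: {2}(#|T| - #|A|)%N (erefl (#|T| - #|A|)%N) => d.
elim: d A => [|d IH] A dA jA A1 lA.
  have AT : A = [set: T].
    by apply/eqP; rewrite eqEcard subsetT cardsT -subn_eq0 dA.
  rewrite AT cardsT in lA; apply: (leq_trans lA); rewrite leq_mul2l /=.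
  by apply: subset_leq_card; apply: subsetIl.
have [|z zA jz] := jordan_step jT jA; first by rewrite A1 -subn_gt0 dA.
have cz : #|z |: A| = #|A|.+1 by rewrite cardsU1 zA.
apply: (IH (z |: A)) => //; rewrite ?cz; first by rewrite subnS dA.
  exact: ltnW A1.
apply: leq_trans (_ : #|A|.+1 * (2 * #|local_group A|) <= _)%N.
  by rewrite factS leq_mul2l lA orbT.
by rewrite mulnCA leq_mul2l /=; apply: local_group_step => //; case: jz.
Qed.

Lemma order_full_cycle A g : perm_on A g -> A \in porbits g -> g ^+ #|A| = 1.
Proof.
move=> gA Ag; apply/permP=> x; rewrite perm1.
have [xA|xA] := boolP (x \in A).
  by rewrite permX (porbits_mem Ag xA) iter_porbit.
by rewrite permX_fix // (out_perm gA).
Qed.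

(** Prime degree forces primitivity: if [g ^+ i] sends one point of [B] to a different one, then i
    is prime to |A|, so a [B] preserved by [g ^+ i] would be preserved by [g] and contain [A]. *)
Lemma prime_jordan A g : g \in G -> perm_on A g -> A \in porbits g -> prime #|A| ->
  jordan A.
Proof.
move=> gG gA Ag pA.
have gon i : perm_on A (g ^+ i).
  by elim: i => [|i IH]; rewrite ?expg0 ?perm_on1 // expgS perm_onM.
split.
  move=> x y xA; rewrite (porbits_mem Ag xA) => /porbitP[i ->].
  by exists (g ^+ i); rewrite ?groupX // -(porbits_mem Ag xA).
move=> B BA /andP[B1 BlA].
have/card_gt1P[a [b [aB bB ab]]] := B1.
have aA := subsetP BA a aB.
have : b \in porbit g a by rewrite -(porbits_mem Ag aA) (subsetP BA).
case/porbitP=> i bi; exists (g ^+ i); first by rewrite groupX.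
have cop : coprime i #|A|.
  rewrite coprime_sym prime_coprime //; apply: contra ab => /dvdnP[q qi].
  by rewrite bi qi mulnC expgM order_full_cycle // expg1n perm1.
split=> //; last by apply/set0Pn; exists b; rewrite inE bB {1}bi mem_im_perm aB.
apply/negP=> /eqP E.
have EB j : (g ^+ i ^+ j) @: B = B.
  by elim: j => [|j IH]; rewrite ?expg0 ?imset_perm1 // expgSr im_permM IH E.
have [j gj] : exists j, g ^+ i ^+ j = g.
  have i0 : 0 < i.
    by rewrite lt0n; apply: contraNneq ab => i0; rewrite bi i0 expg0 perm1.
  case: (egcdnP #|A| i0) => u v Eu _; exists u; move: Eu.
  rewrite (eqP cop) -expgM mulnC => ->.
  by rewrite expgD expg1 mulnC expgM order_full_cycle // expg1n mul1g.
have gB : g @: B = B by rewrite -{1}gj EB.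
have : A \subset B by rewrite (porbits_mem Ag aA) porbit_sub.
by move/subset_leq_card; rewrite leqNgt BlA.
Qed.


Lemma logn_fact_prime p : prime p -> logn p p`! = 1%N.
Proof.
move=> pp; have p0 := prime_gt0 pp.
rewrite -{2}(prednK p0) factS prednK // lognM ?fact_gt0 // (pfactorK 1) //.
suff -> : logn p (p.-1)`! = 0%N by [].
apply/eqP; rewrite -leqn0 leqNgt logn_gt0 mem_primes pp fact_gt0 /=.
have : (p.-1 < p)%N by rewrite prednK.
elim: p.-1 => [|m IH] mp; first by rewrite dvdn1; case: p pp mp {p0} => [|[]].
rewrite factS Euclid_dvdM // negb_or IH ?(ltnW mp) // andbT.
by rewrite gtnNdvd.
Qed.

(* Sylow's theorem in the local group of [A]: its order divides [p!], so the
   subgroups of order [p] are its Sylow [p]-subgroups. *)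
Lemma cycle_normalizer A g (y : {perm T}) : g \in G -> perm_on A g -> A \in porbits g -> prime #|A| ->
  y \in G -> y @: A = A ->
  exists2 k, k \in local_group A & g ^ (y * k) \in <[g]>.
Proof.
move=> gG gA Ag pA yG yA; set p := #|A| in pA.
have og : #[g] = p.
  apply: nt_prime_order => //; first by rewrite order_full_cycle.
  have /card_gt1P[a [b [aA bA ab]]] : 1 < #|A| by apply: prime_gt1.
  apply: contraNneq ab => g1; move: bA; rewrite (porbits_mem Ag aA) => /porbitP[i ->].
  by rewrite g1 expg1n perm1.
have syl h : h \in local_group A -> #[h] = p -> p.-Sylow(local_group A) <[h]>.
  move=> hL oh; rewrite pHallE cycle_subG hL -orderE oh /= p_part.
  have -> : logn p #|local_group A| = 1%N.
    apply/eqP; rewrite eqn_leq; apply/andP; split.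
      rewrite -(logn_fact_prime pA); apply: dvdn_leq_log; rewrite ?fact_gt0 //.
      by rewrite /p -(perm.card_Sym A); apply: cardSg; apply: subsetIr.
    rewrite logn_gt0 mem_primes pA cardG_gt0 /= -oh; exact: order_dvdG.
  by rewrite expn1.
have gL : g \in local_group A by rewrite mem_local_group gG.
have gyL : g ^ y \in local_group A by rewrite mem_local_group groupJ // -{1}yA perm_onJ.
have s1 := syl _ gL og; have s2 : p.-Sylow(local_group A) <[g ^ y]> by apply: syl => //; rewrite orderJ.
have [k kL E] := Sylow_trans s2 s1.
exists k => //; rewrite conjgM E memJ_conjg cycle_id //.
Qed.

(** Adding three points to [A] gives enough transitivity to realise two transpositions of them by
    elements preserving [A]. Sylow's theorem makes these normalise the group generated by [g];
    automorphisms of a cyclic group commute, so their commutator centralises [g]. *)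
Lemma jordan_3cycle A g : jordan [set: T] -> g \in G -> perm_on A g ->
  A \in porbits g -> prime #|A| -> 3 < #|A| -> (#|A| + 3 <= #|T|)%N ->
  exists D e, [/\ e \in G, perm_on D e, D \in porbits e & #|D| = 3].
Proof.
move=> jT gG gA Ag pA p3 pT; set p := #|A| in pA p3 pT.
have jA := prime_jordan gG gA Ag pA.
have [|z1 z1A j1] := jordan_step jT jA; first by rewrite -/p; lia.
set A1 := z1 |: A in j1; have cA1 : #|A1| = p.+1 by rewrite cardsU1 z1A.
have [|z2 z2A j2] := jordan_step jT j1; first by rewrite cA1; lia.
set A2 := z2 |: A1 in j2; have cA2 : #|A2| = p.+2 by rewrite cardsU1 z2A cA1.
have [|z3 z3A j3] := jordan_step jT j2; first by rewrite cA2; lia.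
set A3 := z3 |: A2 in j3.
have [t1 t2 t3] : [/\ trans_on A1, trans_on A2 & trans_on A3] by case: j1 j2 j3 => ? _ [? _] [? _].
have in1 x : (x \in A1) = (x == z1) || (x \in A) by rewrite !inE.
have in2 x : (x \in A2) = (x == z2) || (x \in A1) by rewrite !inE.
have in3 x : (x \in A3) = (x == z3) || (x \in A2) by rewrite !inE.
have n12 : z1 != z2 by apply: contraNneq z2A => <-; rewrite in1 eqxx.
have n13 : z1 != z3 by apply: contraNneq z3A => <-; rewrite in2 in1 eqxx orbT.
have n23 : z2 != z3 by apply: contraNneq z3A => <-; rewrite in2 eqxx.
have z2A' : z2 \notin A by apply: contra z2A; rewrite in1 => ->; rewrite orbT.
have z3A1 : z3 \notin A1 by apply: contra z3A; rewrite in2 => ->; rewrite orbT.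
have z3A' : z3 \notin A by apply: contra z3A1; rewrite in1 => ->; rewrite orbT.
(* Send a to z3 within [A3], then the image of b to z2 within [A2], then that of c to z1 within
   [A1]; each stage fixes the points already placed. *)
have tr3 a b c : a \in A3 -> b \in A3 -> c \in A3 -> [&& a != b, a != c & b != c] ->
    exists2 y, y \in G & [/\ perm_on A3 y, y a = z3, y b = z2 & y c = z1].
  move=> aA bA cA /and3P[ab ac bc].
  have [k3 k3G [k3A k3a]] := t3 a z3 aA (setU11 _ _).
  have b2 : k3 b \in A2.
    have : k3 b \in A3 by rewrite (perm_closed _ k3A).
    by rewrite in3 -k3a (inj_eq perm_inj) eq_sym (negPf ab).
  have [k2 k2G [k2A k2b]] := t2 _ z2 b2 (setU11 _ _).
  have k2z : k2 z3 = z3 by apply: out_perm k2A z3A.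
  have c2 : k2 (k3 c) \in A1.
    have : k3 c \in A3 by rewrite (perm_closed _ k3A).
    rewrite in3 -k3a (inj_eq perm_inj) eq_sym (negPf ac) /=.
    rewrite -(perm_closed _ k2A) in2 -k2b (inj_eq perm_inj) (inj_eq perm_inj) eq_sym.
    by rewrite (negPf bc).
  have [k1 k1G [k1A k1c]] := t1 _ z1 c2 (setU11 _ _).
  have k1z : k1 z3 = z3 by apply: out_perm k1A z3A1.
  have k1z2 : k1 z2 = z2 by apply: out_perm k1A z2A.
  have s23 : A2 \subset A3 by apply: subsetUr.
  have s13 : A1 \subset A3 by apply: subset_trans s23; apply: subsetUr.
  exists (k3 * k2 * k1); first by rewrite !groupM.
  rewrite !permM k3a k2z k1z k2b k1z2 k1c; split=> //.
  by rewrite !perm_onM // ?(perm_on_subset s23 k2A) ?(perm_on_subset s13 k1A).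
have [i1 i2 i3] : [/\ z1 \in A3, z2 \in A3 & z3 \in A3].
  by rewrite !in3 !in2 !in1 !eqxx !orbT.
have AE x : (x \in A) = [&& x \in A3, x != z1, x != z2 & x != z3].
  rewrite in3 in2 in1; case: (x =P z3) => [->|_]; first by rewrite (negPf z3A') !andbF.
  case: (x =P z2) => [->|_]; first by rewrite (negPf z2A') !andbF.
  by case: (x =P z1) => [->|_] /=; rewrite ?(negPf z1A) ?andbF ?andbT.
(* Correcting [y] by an element supported in [A] leaves its action on the added points unchanged. *)
have norm (y : {perm T}) : y \in G -> perm_on A3 y ->
    (forall x, x \in A -> y x \in A) ->
    exists2 Y, Y \in G & [/\ perm_on A3 Y, forall x, x \notin A -> y x \notin A -> Y x = y x, Y @: A = A & g ^ Y \in <[g]>].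
  move=> yG yA3 yA.
  have yAA : y @: A = A.
    by apply/eqP; rewrite eqEcard card_im_perm leqnn andbT; apply/subsetP=> _ /imsetP[x /yA ? ->].
  have [k kL gk] := cycle_normalizer gG gA Ag pA yG yAA.
  move: kL; rewrite mem_local_group => /andP[kG kA].
  exists (y * k); first by rewrite groupM.
  split=> //; last by rewrite im_permM yAA (im_perm_on kA).
    rewrite perm_onM //; apply: perm_on_subset kA; apply/subsetP=> x.
    by rewrite AE => /andP[].
  by move=> x _ yx; rewrite permM (out_perm kA).
(* [y1] swaps z2 and z3 and fixes z1; [y2] swaps z1 and z2 and fixes z3. *)
have [y1 y1G [y1A y12 y13 y11]] := tr3 z2 z3 z1 i2 i3 i1 ltac:(by rewrite n23 ![_ == z1]eq_sym n12 n13).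
have [y2 y2G [y2A y23 y21 y22]] := tr3 z3 z1 z2 i3 i1 i2 ltac:(by rewrite ![z3 == _]eq_sym n13 n23 n12).
have [|Y1 Y1G [Y1A3 Y1z Y1A g1]] := norm y1 y1G y1A.
  move=> x; rewrite !AE (perm_closed _ y1A) => /and4P[-> x1 x2 x3].
  have h z z' : y1 z = z' -> x != z -> y1 x != z' by move=> <-; rewrite (inj_eq perm_inj).
  by rewrite (h _ _ y11 x1) (h _ _ y13 x3) (h _ _ y12 x2).
have [|Y2 Y2G [Y2A3 Y2z Y2A g2]] := norm y2 y2G y2A.
  move=> x; rewrite !AE (perm_closed _ y2A) => /and4P[-> x1 x2 x3].
  have h z z' : y2 z = z' -> x != z -> y2 x != z' by move=> <-; rewrite (inj_eq perm_inj).
  by rewrite (h _ _ y22 x2) (h _ _ y21 x1) (h _ _ y23 x3).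
have Y11 : Y1 z1 = z1 by rewrite Y1z ?y11.
have Y12 : Y1 z2 = z3 by rewrite Y1z ?y12.
have Y13 : Y1 z3 = z2 by rewrite Y1z ?y13.
have Y21 : Y2 z1 = z2 by rewrite Y2z ?y21.
have Y22 : Y2 z2 = z1 by rewrite Y2z ?y22.
have Y23 : Y2 z3 = z3 by rewrite Y2z ?y23.
(* [c] centralises [g], so it acts on [A] as a power of [g], and it permutes the
   three points cyclically; hence [c ^+ (p * p)] is a 3-cycle. *)
pose c := (Y1 * Y2) * (Y2 * Y1)^-1.
have cV x x' : Y2 (Y1 x) = Y1 (Y2 x') -> c x = x'.
  by move=> E; rewrite /c !permM E -[Y1 (Y2 x')]permM permK.
have c1 : c z1 = z3 by apply: cV; rewrite Y11 Y21 Y23 Y13.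
have c2 : c z2 = z1 by apply: cV; rewrite Y12 Y23 Y21 Y12.
have c3 : c z3 = z2 by apply: cV; rewrite Y13 Y22 Y11.
have cg : commute c g.
  have : g ^ c = g.
    case/cycleP: g1 => i g1; case/cycleP: g2 => j g2.
    have E : g ^ (Y1 * Y2) = g ^ (Y2 * Y1).
      by rewrite !conjgM g1 g2 !conjXg g1 g2 -!expgM mulnC.
    by rewrite /c conjgM E conjgK.
  by move/conjg_fixP/commgP.
have cG : c \in G by rewrite !groupM ?groupV ?groupM.
have cA3 : perm_on A3 c by rewrite !perm_onM ?perm_onV ?perm_onM.
have cA : c @: A = A.
  have Y21A : (Y2 * Y1) @: A = A by rewrite im_permM Y2A Y1A.
  by rewrite /c im_permM im_permM Y1A Y2A -{1}Y21A im_permK.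
have [x0 x0A] : exists x, x \in A by apply/set0Pn; rewrite -card_gt0; apply: prime_gt0.
have [i ci] : exists i, forall x, x \in A -> c x = (g ^+ i) x.
  have : c x0 \in porbit g x0 by rewrite -(porbits_mem Ag x0A) -cA mem_im_perm.
  case/porbitP=> i ci; exists i => x; rewrite (porbits_mem Ag x0A) => /porbitP[j ->].
  have cj : commute (g ^+ j) c by apply: commute_sym; apply: commuteX.
  rewrite -permM cj permM ci -!permM -!expgD addnC //.
have giA j x : x \in A -> (c ^+ j) x = (g ^+ (i * j)) x /\ (c ^+ j) x \in A.
  move=> xA; elim: j => [|j [IH1 IH2]]; first by rewrite muln0 !perm1.
  rewrite expgSr permM; split; last by rewrite -cA mem_im_perm.
  by rewrite ci // IH1 -permM -expgD mulnS addnC.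
pose D := [set z1; z2; z3]; pose e := c ^+ (p * p).
have eA x : x \in A -> e x = x.
  move=> xA; rewrite /e (giA _ _ xA).1 mulnA mulnC expgM.
  by rewrite (order_full_cycle gA Ag) expg1n perm1.
(* As p is prime to 3, p^2 is 1 modulo 3, so [e] acts on the three points as [c] does. *)
have [q pq] : exists q, (p * p = q * 3 + 1)%N.
  exists ((p * p) %/ 3)%N; rewrite {1}(divn_eq (p * p) 3); congr (_ + _)%N.
  have : ~~ (3 %| p).
    by rewrite dvdn_prime2 //; apply: contraTneq p3 => <-.
  rewrite /dvdn -modnMm; case: (p %% 3)%N (ltn_pmod p (isT : 0 < 3)%N) => [|[|[]]] //.
have cD x : x \in D -> (c ^+ 3) x = x.
  by rewrite !inE -orbA => /or3P[]/eqP->; rewrite permX /= !(c1, c2, c3).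
have eD x : x \in D -> e x = c x.
  move=> xD; rewrite /e pq expgD expg1 permM mulnC expgM permX_fix //.
  exact: cD.
have eG : e \in G by rewrite groupX.
exists D, e; split=> //.
- apply/subsetP=> x; rewrite inE; apply: contraR => xD.
  have [xA|xA] := boolP (x \in A); first by rewrite eA.
  have xA3 : x \notin A3.
    move: xD xA; rewrite AE !inE => /norP[/norP[-> ->] ->]; by rewrite !andbT.
  by rewrite /e permX_fix // (out_perm cA3).
- apply/imsetP; exists z1 => //.
  have d1 : z1 \in D by rewrite !inE eqxx.
  have d3 : z3 \in D by rewrite !inE eqxx !orbT.
  have e1 : (e ^+ 1) z1 = z3 by rewrite expg1 eD // c1.
  have e2 : (e ^+ 2) z1 = z2 by rewrite permX /= (eD z1) // c1 eD // c3.
  apply/eqP; rewrite eqEsubset; apply/andP; split.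
    apply/subsetP=> x; rewrite !inE -orbA => /or3P[]/eqP->.
    + exact: porbit_id.
    + by rewrite -e2 mem_porbit.
    + by rewrite -e1 mem_porbit.
  apply: porbit_sub => //; apply/eqP; rewrite eqEcard card_im_perm leqnn andbT.
  apply/subsetP=> _ /imsetP[x xD ->]; rewrite eD //.
  by move: xD; rewrite !inE -orbA => /or3P[]/eqP->; rewrite ?(c1, c2, c3) !eqxx ?orbT.
- by rewrite cardsU cards2 cards1 n12 (_ : _ :&: _ = set0) ?cards0 //;
    apply/setP=> x; rewrite !inE; apply/negbTE/negP=> /andP[/orP[]/eqP-> /eqP E];
    rewrite E eqxx in n13 n23.
Qed.

(* Jordan's theorem; the conclusion is the index bound that amounts to containing
   the alternating group. *)
Theorem jordan_prime_cycle A g : jordan [set: T] -> g \in G -> perm_on A g ->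
  A \in porbits g -> prime #|A| -> 3 < #|A| -> (#|A| + 3 <= #|T|)%N ->
  (#|T|`! <= 2 * #|G|)%N.
Proof.
move=> jT gG gA Ag pA p3 pT.
have [D [e [eG eD De cD]]] := jordan_3cycle jT gG gA Ag pA p3 pT.
have jD : jordan D by apply: prime_jordan eG eD De _; rewrite cD.
apply: (jordan_card jT jD); rewrite cD //.
(* Transitivity on three points gives order at least 3 = 3! / 2, the start of the induction. *)
have [z zD] : exists z, z \in D by apply/set0Pn; rewrite -card_gt0 cD.
by rewrite (card_local_group jD.1 zD) cD mulnA -{1}[3`!]muln1 leq_mul2l cardG_gt0.
Qed.

End Jordan.

(** * Actions of symmetric and alternating groups *)

Section Colourings.
Local Open Scope group_scope.
Variable T : finType.

(** Match the points of each colour in enumeration order: the i-th for [h] goes to the i-th for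
    [h']. *)
Lemma perm_colouring (S : eqType) (h h' : T -> S) :
  (forall s, #|[set x | h x == s]| = #|[set x | h' x == s]|) ->
  exists s : {perm T}, forall x, h' (s x) = h x.
Proof.
move=> Hc; pose F c := enum [set y | h y == c]; pose F' c := enum [set y | h' y == c].
have sz c : size (F c) = size (F' c) by rewrite -!cardE.
have iF x : index x (F (h x)) < size (F' (h x)).
  by rewrite -sz index_mem mem_enum inE.
pose f x := nth x (F' (h x)) (index x (F (h x))).
have hf x : h' (f x) = h x.
  by have := mem_nth x (iF x); rewrite mem_enum inE => /eqP.
have finj : injective f.
  move=> x y E; have hxy : h x = h y by rewrite -!hf E.
  move: E; rewrite /f -hxy (set_nth_default x y); last by rewrite hxy iF.
  move/eqP; rewrite nth_uniq ?enum_uniq ?iF //; last by rewrite hxy iF.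
  move/eqP => E.
  rewrite -(nth_index x (_ : x \in F (h x))) ?mem_enum ?inE // E nth_index //.
  by rewrite mem_enum inE hxy.
by exists (perm finj) => x; rewrite permE hf.
Qed.

(** By pigeonhole two points share a colour; composing with their transposition corrects the
    parity. *)
Lemma even_perm_colouring (S : finType) (h h' : T -> S) : #|S| < #|T| ->
  (forall s, #|[set x | h x == s]| = #|[set x | h' x == s]|) ->
  exists2 s : {perm T}, s \in 'Alt_T & forall x, h' (s x) = h x.
Proof.
move=> ST /perm_colouring[s Hs].
have /injectivePn[x [y xy hxy]] : ~~ injectiveb h.
  by apply/negP=> /injectiveP /leq_card; rewrite leqNgt ST.
case: (boolP (s \in 'Alt_T)) => sA; first by exists s.
exists (tperm x y * s).
  by move: sA; rewrite !Alt_even odd_permM odd_tperm xy negbK => ->.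
by move=> z; rewrite permM Hs; case: tpermP => [->|->|].
Qed.

Lemma Alt_homogeneous (A B : {set T}) : 2 < #|T| -> #|A| = #|B| ->
  exists2 s : {perm T}, s \in 'Alt_T & s @: A = B.
Proof.
move=> T2 AB; have [||s sA hs] := @even_perm_colouring bool (mem A) (mem B).
- by rewrite card_bool.
- have c (C : {set T}) : #|[set x | (x \in C) == false]| = #|~: C|.
    by apply: eq_card => x; rewrite !inE; case: (x \in C).
  case; last by rewrite !c -(addKn #|A| #|~: A|) cardsC -(addKn #|B| #|~: B|) cardsC AB.
  by rewrite -[RHS]/(#|_|) (eq_card (B := A)) ?(eq_card (B := B) (A := [set x | (x \in B) == true])) // => x; rewrite !inE eqb_id.
exists s => //; apply/eqP; rewrite eqEcard card_im_perm AB leqnn andbT.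
by apply/subsetP=> _ /imsetP[x xA ->]; rewrite -[_ \in B]/(mem B _) hs.
Qed.

(** Colour each point by its membership in the two sets: four colours, hence the bound on |T|, and
    the three given sizes determine the sizes of all colour classes. *)
Lemma Alt_pair_homogeneous (A B A' B' : {set T}) : 4 < #|T| ->
  #|A| = #|A'| -> #|B| = #|B'| -> #|A :&: B| = #|A' :&: B'| ->
  exists2 s : {perm T}, s \in 'Alt_T & s @: A = A' /\ s @: B = B'.
Proof.
move=> T4 cA cB cAB.
have [||s sA hs] := @even_perm_colouring (bool * bool)%type
    (fun x => (x \in A, x \in B)) (fun x => (x \in A', x \in B')).
- by rewrite card_prod card_bool.
- have c (C D : {set T}) a b : #|[set x | (x \in C, x \in D) == (a, b)]| =
      (if a then if b then #|C :&: D| else #|C| - #|C :&: D|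
       else if b then #|D| - #|C :&: D| else #|T| - (#|C| + (#|D| - #|C :&: D|)))%N.
    have -> : [set x | (x \in C, x \in D) == (a, b)] =
        (if a then C else ~: C) :&: (if b then D else ~: D).
      apply/setP=> x; rewrite !inE xpair_eqE.
      by case: a; case: b; rewrite ?inE; case: (x \in C); case: (x \in D).
    have CD : #|C :\: D| = (#|C| - #|C :&: D|)%N by rewrite cardsD.
    have DC : #|D :\: C| = (#|D| - #|C :&: D|)%N by rewrite cardsD setIC.
    case: a; case: b => //; rewrite -?setDE // ?[~: C :&: D]setIC -?setDE //.
    rewrite setDE -setCU -(addKn #|C :|: D| #|~: _|) cardsC cardsU.
    by rewrite addnBA // subset_leq_card ?subsetIr.
  by case=> a b; rewrite !c cA cB cAB.
exists s => //; split; apply/eqP; rewrite eqEcard card_im_perm ?cA ?cB leqnn andbT;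
  by apply/subsetP=> _ /imsetP[x xA ->]; case: (hs x); rewrite xA.
Qed.

End Colourings.

(** * Rank, fixed points and derangements *)

Section Rank.
Local Open Scope group_scope.
Variables (gT : finGroupType) (T : finType) (to : {action gT &-> T}).

Lemma card_fix_pair w :
  #|'Fix_([set: T * T] | pair_action to)[w]| = (#|'Fix_to[w]| ^ 2)%N.
Proof.
rewrite setTI -mulnn -cardsX; apply: eq_card => -[x y].
by rewrite !inE !sub1set !inE /= xpair_eqE.
Qed.

(* [2 r f <= f^2 + r^2] summed over the non-derangements, where [f] counts fixed
   points and [r] is the rank: the mean of [f] is 1 and that of [f^2] is [r]. *)
Lemma card_non_derangements : [transitive [set: gT], on [set: T] | to] ->
  (#|gT| <= #|~: derangements to| * act_rank to)%N.
Proof.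
move=> tr; set r := act_rank to.
have acts (S : finType) (a : {action gT &-> S}) : [acts [set: gT], on [set: S] | a].
  by apply/actsP=> w _ x; rewrite !inE.
have E1 : (\sum_(w : gT) #|'Fix_to[w]|)%N = #|gT|.
  have := Frobenius_Cauchy (acts _ to).
  rewrite (eq_bigl xpredT) => [|w]; last by rewrite inE.
  under eq_bigr do rewrite setTI.
  move=> ->; rewrite -cardsT; set O := _ @: _.
  suff -> : #|O| = 1%N by rewrite mul1n.
  apply/eqP/cards1P; exists [set: T].
  have [x _ xT] := imsetP tr.
  apply/setP=> A; rewrite inE; apply/imsetP/eqP=> [[y _ ->]|->]; last by exists x.
  by apply: (atransP tr).
have E2 : (\sum_(w : gT) #|'Fix_to[w]| ^ 2)%N = (r * #|gT|)%N.
  have := Frobenius_Cauchy (acts _ (pair_action to)).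
  rewrite (eq_bigl xpredT) => [|w]; last by rewrite inE.
  under eq_bigr do rewrite card_fix_pair.
  by move=> ->; rewrite cardsT.
have D0 w : w \in derangements to -> #|'Fix_to[w]| = 0%N.
  by rewrite inE => /eqP ->; rewrite cards0.
have r0 : 0 < r.
  have [x _ _] := imsetP tr.
  by rewrite card_gt0; apply/set0Pn; exists (orbit (pair_action to) [set: gT] (x, x)); apply: imset_f.
have sumN F : (forall w, w \in derangements to -> F w = 0%N) ->
    (\sum_(w : gT) F w)%N = (\sum_(w in ~: derangements to) F w)%N.
  move=> F0; rewrite (bigID (mem (~: derangements to))) /= [X in (_ + X)%N]big1 ?addn0 //.
  by move=> w; rewrite inE negbK; apply: F0.
have L : (\sum_(w in ~: derangements to) 2 * (r * #|'Fix_to[w]|) <=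
          \sum_(w in ~: derangements to) (#|'Fix_to[w]| ^ 2 + r ^ 2))%N.
  by apply: leq_sum => w _; rewrite [(r * _)%N]mulnC; apply: nat_Cauchy.
move: L; rewrite [leqRHS]big_split /= sum_nat_const -!big_distrr /= -sumN // E1.
rewrite -sumN => [|w /D0 ->//]; rewrite E2 mul2n -addnn leq_add2l.
by rewrite -mulnn mulnA mulnC leq_pmul2r.
Qed.

Lemma act_rank_le (k : nat) (phi : T * T -> 'I_k) :
  (forall u v, phi u = phi v -> exists w, pair_action to u w = v) ->
  (act_rank to <= k)%N.
Proof.
(* [g] sends a value of [phi] to the orbit of some pair with that value; [set0] is the default for
   values not attained. *)
move=> H; pose g j := if [pick u | phi u == j] is Some u
  then orbit (pair_action to) [set: gT] u else set0.
have sub : orbit (pair_action to) [set: gT] @: [set: T * T] \subset g @: [set: 'I_k].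
  apply/subsetP=> _ /imsetP[u _ ->]; apply/imsetP; exists (phi u) => //.
  rewrite /g; case: pickP => [v /eqP vu|/(_ u)]; last by rewrite eqxx.
  have [w uw] := H u v (esym vu).
  by apply/eqP; rewrite orbit_eq_mem orbit_sym; apply/orbitP; exists w; rewrite ?inE.
apply: leq_trans (subset_leq_card sub) _; apply: leq_trans (leq_imset_card _ _) _.
by rewrite cardsT card_ord.
Qed.

End Rank.

Section KsubsetRank.
Local Open Scope group_scope.

Lemma ksubset_act_rank n (G : {group 'S_n}) (T : finType) (to : {action [subg G] &-> T}) k :
  'Alt_('I_n) \subset G -> 4 < n -> is_ksubset_act to k -> (act_rank to <= k.+1)%N.
Proof.
move=> AG n4 [f [finj fim fact]].
have cf x : #|f x| = k.
  by have : f x \in f @: [set: T]; [apply: imset_f | rewrite fim inE => /eqP].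
have lf u : #|f u.1 :&: f u.2| < k.+1.
  by rewrite ltnS -(cf u.1) subset_leq_card ?subsetIl.
apply: (@act_rank_le _ _ _ k.+1 (fun u => Ordinal (lf u))) => -[x y] [x' y'] /(congr1 val) /= E.
have [||||s sA [sx sy]] := @Alt_pair_homogeneous _ (f x) (f y) (f x') (f y'); rewrite ?card_ord ?cf //.
have sG := subsetP AG s sA.
exists (subg G s); congr (_, _); apply: finj; rewrite fact subgK //.
Qed.

End KsubsetRank.

(** * Conjugation, and powers of a permutation with a lone cycle *)

Section Conjugation.
Local Open Scope group_scope.
Variable T : finType.
Implicit Types (u w s : {perm T}) (A D X : {set T}).

Lemma porbitJ w s x : porbit (w ^ s) (s x) = s @: porbit w x.
Proof.
apply/setP=> y; apply/porbitP/imsetP=> [[i ->]|[z /porbitP[i ->] ->]].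
  by exists ((w ^+ i) x); rewrite ?mem_porbit // -conjXg permJ.
by exists i; rewrite -conjXg permJ.
Qed.

Lemma mem_porbitsJ w s X : (s @: X \in porbits (w ^ s)) = (X \in porbits w).
Proof.
apply/imsetP/imsetP=> -[x _ E].
  exists (s^-1 x) => //; rewrite -(im_permK s X) E -{1}(permKV s x) porbitJ.
  by rewrite im_permK.
by exists (s x); rewrite // porbitJ E.
Qed.

Lemma mem_lone_cycleJ P w s : w \in lone_cycle T P -> w ^ s \in lone_cycle T P.
Proof.
rewrite !inE => /existsP[X /and3P[Xw PX /forallP nd]].
apply/existsP; exists (s @: X); rewrite mem_porbitsJ Xw card_im_perm PX /=.
apply/forallP=> Y; rewrite -(im_permKV s Y) mem_porbitsJ card_im_perm.
by rewrite (inj_eq (imset_inj perm_inj)); apply: nd.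
Qed.

Lemma mem_fixes_ksetJ k w s : w ^ s \in fixes_kset T k -> w \in fixes_kset T k.
Proof.
rewrite !inE => /existsP[A /andP[Ak /eqP wA]]; apply/existsP; exists (s^-1 @: A).
rewrite card_im_perm Ak /= -{2}wA /conjg !im_permM im_permK.
by rewrite eqxx.
Qed.

(** Raise [u] to the product m of the other cycle lengths: this kills the other cycles, and m is
    prime to |X|, so [X] remains one cycle. *)
Lemma lone_cycle_power u X : X \in porbits u -> prime #|X| ->
  (forall Y, Y \in porbits u -> Y != X -> ~~ (#|X| %| #|Y|)) ->
  exists i, perm_on X (u ^+ i) /\ X \in porbits (u ^+ i).
Proof.
move=> Xu pX nd; set p := #|X| in pX nd.
pose m := (\prod_(Y in porbits u | Y != X) #|Y|)%N.
have pm : ~~ (p %| m).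
  rewrite /m; elim/big_ind: _ => [|a b pa pb|Y /andP[Yu YX]]; last exact: nd.
    by rewrite dvdn1 neq_ltn prime_gt1 ?orbT.
  by rewrite Euclid_dvdM // negb_or pa pb.
exists m; split.
  apply/subsetP=> x; rewrite inE; apply: contraR => xX.
  have Yu := mem_porbits u x.
  have YX : porbit u x != X by apply: contraNneq xX => <-; apply: porbit_id.
  rewrite /m (bigD1 (porbit u x)) ?Yu //= expgM permX_fix //.
  by rewrite permX iter_porbit.
have [y yX] : exists y, y \in X by apply/set0Pn; apply: porbits_neq0 Xu.
have XE := porbits_mem Xu yX.
have up j : (u ^+ (p * j)) y = y by rewrite expgM permX_fix // permX /p XE iter_porbit.
have m0 : 0 < m by rewrite lt0n; apply: contraNneq pm => ->; apply: dvdn0.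
case: (egcdnP p m0) => v q Ev _.
have cop : gcdn m p = 1%N by apply/eqP; rewrite -/(coprime m p) coprime_sym prime_coprime.
rewrite cop in Ev.
apply/imsetP; exists y => //; rewrite {1}XE; apply/setP=> z.
apply/porbitP/porbitP=> -[j ->]; last by exists (m * j)%N; rewrite expgM.
exists (v * j)%N; rewrite -expgM mulnA (mulnC m) Ev mulnDl mul1n -mulnA mulnCA expgD permM.
by rewrite up.
Qed.

(** [D] plays the part of a block meeting the lone cycle, of length p, in y. As u^p fixes y, it
    preserves [D]. If u did not, every i with u^i preserving [D] would be a multiple of p; for
    another point z of [D] this makes p divide its cycle length, so z = u^i y lies in [X], and then
    p divides i and z = y. *)
Lemma lone_block_fixed u X D y : X \in porbits u -> prime #|X| ->
  (forall Y, Y \in porbits u -> Y != X -> ~~ (#|X| %| #|Y|)) ->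
  y \in X -> y \in D -> 1 < #|D| ->
  (forall i, (u ^+ i) @: D :&: D != set0 -> (u ^+ i) @: D = D) ->
  u @: D = D /\ (#|X| <= #|D|)%N.
Proof.
move=> Xu pX nd yX yD D1 blk; set p := #|X| in pX nd *.
have XE := porbits_mem Xu yX.
have upD : (u ^+ p) @: D = D.
  apply: blk; apply/set0Pn; exists y; rewrite inE yD andbT.
  have E : (u ^+ p) y = y by rewrite permX /p XE iter_porbit.
  by rewrite -{1}E mem_im_perm.
have upjD j : (u ^+ (p * j)) @: D = D.
  by elim: j => [|j IH]; rewrite ?muln0 ?expg0 ?imset_perm1 // mulnS expgD im_permM upD IH.
suff uD : u @: D = D.
  by split=> //; rewrite /p XE subset_leq_card // porbit_sub.
apply/eqP; apply/negPn/negP => nuD.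
have dvd i : (u ^+ i) @: D = D -> p %| i.
  move=> uiD; apply: contraR nuD => npi.
  have i0 : 0 < i by rewrite lt0n; apply: contraNneq npi => ->; apply: dvdn0.
  case: (egcdnP p i0) => v q Ev _; move: Ev.
  have -> : gcdn i p = 1%N by apply/eqP; rewrite -/(coprime i p) coprime_sym prime_coprime.
  move=> Ev.
  have : (u ^+ (v * i)) @: D = D.
    elim: v {Ev} => [|v IH]; first by rewrite mul0n expg0 imset_perm1.
    by rewrite mulSn expgD im_permM uiD IH.
  by rewrite Ev mulnC expgD expg1 im_permM upjD => ->.
have /card_gt1P[a [b [aD bD ab]]] := D1.
have [z zD zy] : exists2 z, z \in D & z != y.
  by case: (eqVneq a y) => [E|]; [exists b; rewrite // -E eq_sym | exists a].
have : p %| #|porbit u z|.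
  apply: dvd; apply: blk; apply/set0Pn; exists z; rewrite inE zD andbT.
  by rewrite -{1}(iter_porbit u z) -permX mem_im_perm.
case: (eqVneq (porbit u z) X) => [E _|nX]; last by apply/negP; apply: nd => //; apply: mem_porbits.
have : z \in porbit u y by rewrite -XE -E porbit_id.
case/porbitP=> i zi.
have /dvdnP[j ij] : p %| i.
  apply: dvd; apply: blk; apply/set0Pn; exists z; rewrite inE zD andbT {1}zi.
  by rewrite mem_im_perm.
move/eqP: zy; apply; rewrite zi ij mulnC expgM permX_fix //.
by rewrite permX /p XE iter_porbit.
Qed.

End Conjugation.

Lemma card_subg_type (gT : finGroupType) (G : {group gT}) : #|{: [subg G]}| = #|G|.
Proof. by rewrite -cardsT -(card_injm (injm_sgval G) (subxx _)) im_sgval. Qed.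

(** * Point stabilisers of a primitive action *)

Section PointStabiliser.
Local Open Scope group_scope.
Variables (n : nat) (G : {group 'S_n}) (Om : finType) (to : {action [subg G] &-> Om}).
Hypotheses (AG : 'Alt_('I_n) \subset G) (n4 : 4 < n).
Hypotheses (prim : primitive_act to) (Om3 : (3 <= #|Om|)%N).
Variable x0 : Om.

Let tr : [transitive [set: [subg G]], on [set: Om] | to].
Proof. by case/andP: prim. Qed.

Definition stab_in_Sn := (@sgval _ G @* 'C[x0 | to])%G.
Let M := stab_in_Sn.

Lemma mem_stab w : (sgval w \in M) = (to x0 w == x0).
Proof.
apply/idP/eqP=> [/morphimP[v _ /astab1P vx /val_inj ->]//|wx].
by apply: mem_morphim; [rewrite inE | apply/astab1P].
Qed.

Lemma stab_sub : M \subset G.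
Proof. by apply/subsetP=> _ /morphimP[w _ _ ->]; apply: subgP. Qed.

Lemma reach y : exists w, to x0 w = y.
Proof. by have [w _ ->] := atransP2 tr (in_setT x0) (in_setT y); exists w. Qed.

Lemma non_derangement_conj w : w \notin derangements to ->
  exists2 s, s \in G & sgval w ^ s \in M.
Proof.
rewrite inE => /set0Pn[y /afix1P yw]; have [v vy] := reach y.
exists (sgval v^-1); first exact: subgP.
rewrite -morphJ ?inE // mem_stab; apply/eqP.
by rewrite /conjg invgK !actM vy yw -vy actK.
Qed.

Lemma card_stab : #|G| = (#|Om| * #|M|)%N.
Proof.
have := card_orbit_stab to [set: [subg G]] x0; rewrite (atransP tr) ?inE // cardsT.
rewrite cardsT card_subg_type; move=> <-; congr (_ * _)%N; rewrite setTI /=.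
by rewrite card_injm ?injm_sgval ?subsetT.
Qed.

(** The use of |Omega| >= 3: M has index at least 3 in G. This contradicts the conclusion n! <= 2
    |M| of Jordan's theorem. *)
Lemma stab_small : (2 * #|M| < n`!)%N.
Proof.
have : (#|G| <= n`!)%N by rewrite -card_Sn max_card.
rewrite card_stab; have := cardG_gt0 M; nia.
Qed.

(** Primitivity says that the point stabiliser is maximal in [[subg G]]; preimages transport this to
    subgroups of ['S_n]. *)
Lemma stab_maximal (K : {group 'S_n}) : M \subset K -> K \subset G -> K != G -> M :=: K.
Proof.
move=> MK KG nKG; have := trans_prim_astab (in_setT x0) tr.
rewrite (prim : [primitive [set: [subg G]], on [set: Om] | to]) => /esym/maximal_eqP[_ mx].
have KE : sgval @* (@sgval _ G @*^-1 K) = K by rewrite morphpreK // im_sgval.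
have [||E|E] := mx (@sgval _ G @*^-1 K)%G; rewrite ?subsetT //.
- apply/subsetP=> w /setIP[_ cw]; apply/morphpreP; split; first by rewrite inE.
  by apply: (subsetP MK); apply: mem_morphim cw; rewrite inE.
- by rewrite /= setTI in E; rewrite -KE E.
case/negP: nKG; apply/eqP/group_inj; rewrite /= in E.
by rewrite -KE E im_sgval.
Qed.

Section Intransitive.
Variable A : {set 'I_n}.
Hypotheses (A0 : A != set0) (AT : A != [set: 'I_n]).
Hypothesis MA : forall g, g \in M -> g @: A = A.

(** By maximality M is the whole setwise stabiliser of [A] in G, which is proper because an even
    permutation moves a point of [A] outside. *)
Lemma mem_stab_set s : s \in G -> (s \in M) = (s @: A == A).
Proof.
move=> sG; pose K := 'N_G(A | 'P)%G.
have memK g : (g \in K) = (g \in G) && (g @: A == A).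
  rewrite inE; congr (_ && _); apply/idP/eqP=> [/astabs_setact//|gA].
  by apply/astabsP=> x; rewrite /= apermE -{1}gA mem_im_perm.
suff -> : M :=: K by rewrite memK sG.
apply: stab_maximal; rewrite ?subsetIl //.
  by apply/subsetP=> g gM; rewrite memK (subsetP stab_sub _ gM) MA // eqxx.
apply/negP=> /eqP KG.
have [a aA] := set0Pn _ A0.
have [b _ bA] : exists2 b, b \in [set: 'I_n] & b \notin A.
  by apply/subsetPn; rewrite subTset.
have [||g gA gab] := @Alt_homogeneous 'I_n [set a] [set b]; rewrite ?card_ord ?cards1 //.
  exact: ltn_trans n4.
have : g \in K by rewrite KG (subsetP AG).
rewrite memK => /andP[_ /eqP E]; case/negP: bA.
by move: (set11 b); rewrite -gab imset_set1 inE => /eqP ->; rewrite -E mem_im_perm.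
Qed.

(** Send the point reached from [x0] by w to w(A). This is well defined since M preserves [A],
    injective since M is the full stabiliser of [A], and onto the sets of size |A| since the
    alternating group permutes these transitively. *)
Lemma is_ksubset_stab : is_ksubset_act to #|A|.
Proof.
have [g gE] := fin_all_exists reach.
pose f y := sgval (g y) @: A.
have fE w : f (to x0 w) = sgval w @: A.
  rewrite /f; set y := to x0 w.
  have uM : sgval (g y * w^-1) \in M by rewrite mem_stab actM gE /y actK.
  have -> : sgval (g y) = sgval (g y * w^-1) * sgval w by rewrite -[RHS]/(sgval (g y * w^-1 * w)) mulgKV.
  by rewrite im_permM MA.
exists f; split.
- move=> y y' E.
  have : sgval (g y * (g y')^-1) \in M.
    rewrite mem_stab_set ?subgP // -[sgval _]/(sgval (g y) * (sgval (g y'))^-1) im_permM.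
    by rewrite -/(f y) E /f im_permK.
  rewrite mem_stab actM gE => /eqP E2.
  by rewrite -[y](actKV to (g y')) E2 gE.
- apply/setP=> B; rewrite inE; apply/imsetP/eqP=> [[y _ ->]|cB]; first exact: card_im_perm.
  have [||s sA sB] := @Alt_homogeneous 'I_n A B; rewrite ?card_ord ?cB //.
    exact: ltn_trans n4.
  exists (to x0 (subg G s)); rewrite ?inE // fE subgK //.
  exact: (subsetP AG).
- move=> x w; have [v <-] := reach x.
  by rewrite -actM !fE im_permM.
Qed.

Lemma fixes_ksubset w : w \notin derangements to -> sgval w \in fixes_kset 'I_n #|A|.
Proof.
case/non_derangement_conj=> s _ /MA wA; apply: (@mem_fixes_ksetJ _ _ _ s).
by rewrite inE; apply/existsP; exists A; rewrite eqxx wA eqxx.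
Qed.

End Intransitive.


Lemma stab_transitive :
  ~~ [exists A : {set 'I_n}, [&& A != set0, A != [set: 'I_n] & [forall g in M, g @: A == A]]] ->
  trans_on M [set: 'I_n].
Proof.
move=> nex x y _ _; pose O := orbit 'P M x.
have OT : O = [set: 'I_n].
  apply/eqP; apply: contraNT nex => OT; apply/existsP; exists O; rewrite OT.
  have -> : O != set0 by apply/set0Pn; exists x; apply: orbit_refl.
  apply/forall_inP=> g gM; rewrite eqEcard card_im_perm leqnn andbT.
  by apply/subsetP=> _ /imsetP[z zO ->]; rewrite -[g z]/(aperm z g) orbit_actr.
have : y \in O by rewrite OT inE.
case/orbitP=> g gM <-; exists g => //; split=> //.
by apply/subsetP=> z; rewrite !inE.
Qed.

(** The cases M intransitive, M primitive and M imprimitive. The second alternative also covers an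
    imprimitive M for which no non-derangement has a lone cycle; otherwise such an element supplies
    the bound p <= a on the block size. *)
Lemma stab_trichotomy (P : pred nat) :
  (forall p, P p -> [/\ prime p, 3 < p & (p + 3 <= n)%N]) ->
  [\/ exists k, [/\ 0 < k, (k.*2 <= n)%N, is_ksubset_act to k
        & forall w, w \notin derangements to -> sgval w \in fixes_kset 'I_n k],
      forall w, w \notin derangements to -> sgval w \notin lone_cycle 'I_n P
    | exists a, [/\ (a.*2 <= n)%N, exists2 p, P p & (p <= a)%N
        & forall w, w \notin derangements to -> sgval w \in lone_cycle 'I_n P ->
            sgval w \in fixes_kset 'I_n a]].
Proof.
move=> hP.
have [/existsP[A0 /and3P[A00 A0T /forall_inP A0M]]|/stab_transitive Mtr] :=
  boolP [exists A : {set 'I_n}, [&& A != set0, A != [set: 'I_n] & [forall g in M, g @: A == A]]].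
  (* A set or its complement has at most n / 2 points, and M preserves both. *)
  have [A [AN AT MA A2]] : exists A : {set 'I_n}, [/\ A != set0, A != [set: 'I_n],
      forall g, g \in M -> g @: A = A & (#|A|.*2 <= n)%N].
    case: (leqP #|A0|.*2 n) => [A2|A2].
      by exists A0; split=> // g /A0M /eqP.
    exists (~: A0); split.
    - by apply: contra A0T => /eqP E; rewrite -(setCK A0) E setC0.
    - by apply: contra A00 => /eqP E; rewrite -(setCK A0) E setCT.
    - move=> g gM; rewrite -setTD im_permD (eqP (A0M g gM)); congr (_ :\: _).
      by apply/eqP; rewrite eqEcard subsetT card_im_perm leqnn.
    - by have := cardsC A0; rewrite card_ord; lia.
  apply: Or31; exists #|A|; split=> //; first by rewrite card_gt0.
  + exact: is_ksubset_stab.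
  + exact: fixes_ksubset.
have lone w : w \notin derangements to -> sgval w \in lone_cycle 'I_n P ->
    exists u X s, [/\ u \in M, u = sgval w ^ s, X \in porbits u, P #|X| &
      forall Y, Y \in porbits u -> Y != X -> ~~ (#|X| %| #|Y|)].
  case/non_derangement_conj=> s _ wM /(mem_lone_cycleJ s).
  rewrite inE => /existsP[X /and3P[Xw PX /forall_inP nd]].
  by exists (sgval w ^ s), X, s; split=> // Y /nd /implyP.
have [/existsP[B /andP[lB /forall_inP MB]]|nex] := boolP [exists B : {set 'I_n},
    (1 < #|B| < n) && [forall g in M, (g @: B == B) || (g @: B :&: B == set0)]].
  have [/existsP[w0 /andP[w0D w0l]]|nw] :=
    boolP [exists w, (w \notin derangements to) && (sgval w \in lone_cycle 'I_n P)]; last first.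
    apply: Or32 => w wD; apply: contra nw => wl; apply/existsP; exists w.
    by rewrite wD.
  have [b0 b0B] : exists b, b \in B by apply/set0Pn; rewrite -card_gt0; case/andP: lB => /ltnW.
  have key w : w \notin derangements to -> sgval w \in lone_cycle 'I_n P ->
      sgval w \in fixes_kset 'I_n #|B| /\ exists2 p, P p & (p <= #|B|)%N.
    move=> wD /(lone w wD)[u [X [s [uM uE Xu PX nd]]]].
    have [pX _ _] := hP _ PX.
    have [y yX] : exists y, y \in X by apply/set0Pn; apply: porbits_neq0 Xu.
    (* As M is transitive, some translate of [B] meets the lone cycle. *)
    have [g gM [_ gy]] := Mtr b0 y (in_setT _) (in_setT _).
    have [|||uD XD] := @lone_block_fixed _ u X (g @: B) y Xu pX nd yX.
    - by rewrite -gy mem_im_perm.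
    - by rewrite card_im_perm; case/andP: lB.
    - move=> i.
      have hM : g * u ^+ i * g^-1 \in M by rewrite !groupM ?groupX ?groupV.
      have E : (u ^+ i) @: (g @: B) = g @: ((g * u ^+ i * g^-1) @: B).
        by rewrite !im_permM im_permKV.
      rewrite E -im_permI -card_gt0 card_im_perm card_gt0.
      by case/orP: (MB _ hM) => [/eqP ->//|/eqP ->]; rewrite eqxx.
    rewrite card_im_perm in XD; split; last by exists #|X|.
    apply: (@mem_fixes_ksetJ _ _ _ s); rewrite -uE inE; apply/existsP.
    by exists (g @: B); rewrite card_im_perm eqxx uD eqxx.
  apply: Or33; exists #|B|; split; last by move=> w wD /(key w wD)[].
    have [x xB] : exists x, x \notin B.
      have : ~~ ([set: 'I_n] \subset B).
        by apply/negP=> /subset_leq_card; rewrite cardsT card_ord leqNgt; case/andP: lB => _ ->.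
      by case/subsetPn=> x _ xB; exists x.
    have [g gM [_ gx]] := Mtr b0 x (in_setT _) (in_setT _).
    case/orP: (MB g gM) => /eqP E.
      by case/negP: xB; rewrite -gx -E mem_im_perm.
    rewrite -addnn -{1}(card_im_perm g B) -cardsUI E cards0 addn0.
    by rewrite -[X in (_ <= X)%N](card_ord n) max_card.
  by have [] := key w0 w0D w0l.
apply: Or32 => w wD; apply/negP=> /(lone w wD)[u [X [s [uM uE Xu PX nd]]]].
have [pX X3 Xn] := hP _ PX.
have [i [ui Xi]] := lone_cycle_power Xu pX nd.
have jM : jordan M [set: 'I_n].
  split=> // B _ lB; move: nex; rewrite negb_exists => /forallP/(_ B).
  rewrite cardsT card_ord in lB; rewrite lB /= negb_forall => /existsP[g].
  rewrite negb_imply negb_or => /and3P[gM g1 g2]; exists g => //; split=> //.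
  by apply/subsetP=> z; rewrite !inE.
have := jordan_prime_cycle jM (groupX i uM) ui Xi pX X3.
rewrite card_ord => /(_ Xn); rewrite leqNgt; apply/negP/negPn; exact: stab_small.
Qed.

End PointStabiliser.

From mathcomp Require Import boolp classical_sets reals topology normedtype sequences exp.
Import numFieldNormedType.Exports.

(** * Sums of reciprocals of primes *)

Section Primes.
Variable R : realType.
Local Open Scope ring_scope.

Definition smooth k j := all (fun q => q <= k)%N (primes j).

(** For a prime p this is 1 / (1 - 1 / p), the geometric series of 1 / p. *)
Definition euler_factor p : R := if prime p then p%:R / (p%:R - 1) else 1.

Definition euler_prod k : R := \prod_(1 <= p < k.+1) euler_factor p.

Lemma euler_factor_ge1 p : 1 <= euler_factor p.
Proof.
rewrite /euler_factor; case: ifP => // /prime_gt1 p1.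
have p1r : 1 < p%:R :> R by rewrite ltr1n.
by rewrite ler_pdivlMr; lra.
Qed.

Lemma euler_prodS k : euler_prod k.+1 = euler_prod k * euler_factor k.+1.
Proof. by rewrite /euler_prod big_nat_recr. Qed.

Lemma euler_prod_gt0 k : 0 < euler_prod k.
Proof.
elim: k => [|k IH]; first by rewrite /euler_prod big_geq.
by rewrite euler_prodS mulr_gt0 // (lt_le_trans ltr01) ?euler_factor_ge1.
Qed.

(* Splitting off the multiples of the prime [p = k.+1] gives
   [F p N <= F k N + F p N / p], where [F] denotes the left-hand side. *)
Lemma harm_smooth_le k N : harm (ind R (smooth k)) N <= euler_prod k.
Proof.
elim: k N => [|k IH] N.
  rewrite /euler_prod big_geq // /harm.
  case: N => [|N]; first by rewrite big_geq.
  rewrite big_ltn // [X in _ + X]big_nat big1.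
    by rewrite /ind /smooth divr1 addr0.
  move=> j /andP[j1 _]; rewrite /ind; case: (boolP (smooth 0 j)); last by rewrite mul0r.
  move=> /allP /(_ (pdiv j)); rewrite mem_primes pdiv_prime // pdiv_dvd (ltnW j1) => /(_ isT).
  by rewrite leqNgt pdiv_gt0.
rewrite euler_prodS /euler_factor; case: ifP => pk; last first.
  rewrite mulr1; apply: le_trans (IH N); rewrite le_eqVlt; apply/orP; left; apply/eqP.
  apply: eq_bigr => j _; congr (_%:R / _); congr nat_of_bool.
  apply: eq_in_all => q; rewrite mem_primes => /and3P[pq _ _].
  by rewrite leq_eqVlt ltnS; case: eqP => // E; rewrite E pk in pq.
set p := k.+1; have p0 : (0 < p)%N by [].
have p1 : 1 < p%:R :> R by rewrite ltr1n prime_gt1.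
set F := harm _ N.
have : F <= harm (ind R (smooth k)) N + F / p%:R.
  apply: (@le_trans _ _ (harm (ind R (smooth k)) N + harm (ind R (smooth p)) (N %/ p) / p%:R)).
    rewrite -harm_dvdn // /F /harm -big_split /=.
    rewrite !big_nat; apply: ler_sum => j /andP[j0 _]; rewrite -mulrDl ler_wpM2r ?invr_ge0 //.
    rewrite /ind; case: (boolP (smooth p j)) => sj; last by rewrite addr_ge0 ?mulr_ge0 ?ler0n.
    case: (boolP (p %| j)%N) => pj.
      have -> : smooth p (j %/ p).
        apply/allP=> q; rewrite mem_primes => /and3P[pq _ qj].
        move/allP: sj => /(_ q); apply; rewrite mem_primes pq j0 /=.
        by apply: dvdn_trans qj _; rewrite -{2}(divnK pj) dvdn_mulr.
      by rewrite mul1r lerDr ler0n.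
    have -> : smooth k j.
      apply/allP=> q qj; move/allP: sj => /(_ q qj); rewrite leq_eqVlt ltnS.
      by case: eqP => // E; move: qj; rewrite mem_primes E (negPf pj) !andbF.
    by rewrite lerDl mulr_ge0 ?ler0n.
  rewrite lerD2l ler_wpM2r ?invr_ge0 //; apply: harm_mono; last exact: leq_div.
  exact: ind_ge0.
move: (IH N); set G := harm _ N; set E := euler_prod k => GE FG.
have FE : F * (p%:R - 1) <= E * p%:R.
  have pp : 0 <= p%:R :> R by lra.
  have h := ler_wpM2r pp FG; rewrite mulrDl divfK in h; last by lra.
  have := ler_wpM2r pp GE; lra.
by rewrite mulrA ler_pdivlMr //; lra.
Qed.

Lemma Hsum_le_euler_prod N : Hsum R N <= euler_prod N.
Proof.
apply: le_trans (harm_smooth_le N N); rewrite /Hsum /harm !big_nat; apply: ler_sum.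
move=> j /andP[j0 jN]; rewrite ler_wpM2r ?invr_ge0 //; suff -> : ind R (smooth N) j = 1 by [].
rewrite /ind (_ : smooth N j) //; apply/allP=> q; rewrite mem_primes => /and3P[_ _ qj].
by apply: leq_trans (dvdn_leq j0 qj) _.
Qed.

Let euler_factor1 : euler_factor 1 = 1. Proof. by rewrite /euler_factor. Qed.
Let euler_factor2 : euler_factor 2 = 2.
Proof. by rewrite /euler_factor /= (_ : 2 - 1 = 1 :> R) ?divr1 //; lra. Qed.
Let euler_factor3 : euler_factor 3 = 3 / 2.
Proof. by rewrite /euler_factor /= (_ : 3 - 1 = 2 :> R) //; lra. Qed.

(* Only odd numbers are used: [(p / (p - 1)) ^ 2 <= p / (p - 2)] telescopes. *)
Lemma euler_prod_odd t : euler_prod t.*2.+3 ^+ 2 <= 4 * t.*2.+3%:R.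
Proof.
elim: t => [|t IH].
  rewrite double0 !euler_prodS /euler_prod big_geq // euler_factor1 euler_factor2 euler_factor3 expr2; lra.
rewrite doubleS euler_prodS (euler_prodS t.*2.+3).
have -> : euler_factor t.*2.+4 = 1.
  rewrite /euler_factor; case: ifP => // /even_prime [] //=.
  by rewrite negbK odd_double.
rewrite mulr1 exprMn.
have f0 : 0 <= euler_factor t.*2.+3.+2 by apply: le_trans ler01 (euler_factor_ge1 _).
have : euler_factor t.*2.+3.+2 <= t.*2.+3.+2%:R / (t.*2.+3.+2%:R - 1).
  rewrite /euler_factor; case: ifP => // _; rewrite ler_pdivlMr ?mul1r; last by rewrite subr_gt0 ltr1n.
  by rewrite gerBl.
set a : R := t.*2.+3%:R in IH *.
have -> : t.*2.+3.+2%:R = a + 2 by rewrite -natrD addn2.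
have a0 : 0 < a by rewrite ltr0n.
move=> fle.
have f2 : euler_factor t.*2.+3.+2 ^+ 2 <= ((a + 2) / (a + 2 - 1)) ^+ 2.
  by rewrite lerXn2r ?nnegrE // divr_ge0; lra.
apply: (le_trans (ler_pM _ _ IH f2)); rewrite ?sqr_ge0 //.
rewrite exprMn exprVn mulrA ler_pdivrMr; last by rewrite exprn_gt0; lra.
by rewrite -subr_ge0 (_ : _ - _ = 4 * (a + 2)); [lra | ring].
Qed.

Lemma euler_prod_le k : (0 < k)%N -> euler_prod k ^+ 2 <= 4 * k%:R.
Proof.
move=> k0; case: k k0 => [//|[|[|k]]] _.
- by rewrite euler_prodS /euler_prod big_geq // euler_factor1 expr2; lra.
- by rewrite !euler_prodS /euler_prod big_geq // euler_factor1 euler_factor2 expr2; lra.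
rewrite -(odd_double_half k); case: (odd k); last by rewrite add0n; apply: euler_prod_odd.
rewrite add1n euler_prodS.
have -> : euler_factor (k./2).*2.+4 = 1.
  rewrite /euler_factor; case: ifP => // /even_prime [] //=.
  by rewrite negbK odd_double.
rewrite mulr1; apply: (le_trans (euler_prod_odd _)).
by rewrite ler_wpM2l // ler_nat.
Qed.

Definition prime_sum M N : R := \sum_(M.+1 <= p < N.+1) ind R prime p / p%:R.

(** For p >= 2, p / (p - 1) <= 1 + 2 / p <= exp(2 / p). *)
Lemma euler_prod_ratio M N : (0 < M)%N ->
  euler_prod N <= euler_prod M * expR (2 * prime_sum M N).
Proof.
move=> M0; case: (leqP N M) => NM.
  have -> : prime_sum M N = 0 by rewrite /prime_sum big_geq // ltnS.
  rewrite mulr0 expR0 mulr1 -(subnK NM); elim: (M - N)%N => [|d IH]; first by rewrite add0n.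
  rewrite addSn euler_prodS; apply: (le_trans IH).
  by rewrite ler_peMr ?euler_factor_ge1 // ltW // euler_prod_gt0.
move/ltnW: NM => NM; rewrite -(subnK NM); elim: (N - M)%N => [|d IH].
  by rewrite add0n /prime_sum big_geq // mulr0 expR0 mulr1.
rewrite addSn euler_prodS /prime_sum big_nat_recr /=; last by rewrite ltnS leq_addl.
rewrite mulrDr expRD mulrA; apply: ler_pM => //; first exact/ltW/euler_prod_gt0.
  by apply: le_trans ler01 (euler_factor_ge1 _).
set q := (d + M).+1; rewrite /euler_factor /ind; case: ifP => pq; last first.
  by rewrite mul0r mulr0 expR0.
have q1 : 2 <= q%:R :> R by rewrite ler_nat prime_gt1.
apply: le_trans (expR_ge1Dx _); rewrite mul1r ler_pdivrMr; last lra.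
rewrite -subr_ge0 (_ : _ - _ = (q%:R - 2) / q%:R); last by field; lra.
by rewrite divr_ge0; lra.
Qed.

(** Each of the k dyadic blocks contributes at least 1 / 2. *)
Lemma Hsum_double k : k%:R / 2 <= Hsum R (2 ^ k).
Proof.
elim: k => [|k IH]; first by rewrite mul0r Hsum_ge0.
have k0 : (0 < 2 ^ k)%N by rewrite expn_gt0.
rewrite expnS mul2n -addnn /Hsum /harm (@big_cat_nat _ _ _ (2 ^ k).+1) //=; last by rewrite ltnS leq_addr.
rewrite -natr1 mulrDl; apply: lerD => //.
apply: (@le_trans _ _ (\sum_((2 ^ k).+1 <= i < (2 ^ k + 2 ^ k).+1) ((2 ^ k + 2 ^ k)%N%:R)^-1)).
  rewrite sumr_const_nat subSS addnK natrD -mulr_natr.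
  have : 0 < (2 ^ k)%N%:R :> R by rewrite ltr0n.
  set x := _%:R => x0; rewrite le_eqVlt; apply/orP; left; apply/eqP.
  by field; lra.
rewrite !big_nat; apply: ler_sum => j /andP[j1 j2].
rewrite mul1r lef_pV2 ?posrE ?ltr0n; try lia.
by rewrite ler_nat.
Qed.

Lemma Hsum_le_nat N : Hsum R N <= N%:R.
Proof.
elim: N => [|N IH]; first by rewrite /Hsum /harm big_geq.
rewrite /Hsum /harm big_nat_recr //= -[leRHS]natr1; apply: lerD => //.
by rewrite mul1r invf_le1 ?ltr0n // ler1n.
Qed.

Lemma Hsum_addn N d : Hsum R (N + d) <= Hsum R N + d%:R.
Proof.
elim: d => [|d IH]; first by rewrite addn0 addr0.
rewrite addnS /Hsum /harm big_nat_recr //= -[d.+1%:R]natr1 addrA; apply: lerD => //.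
by rewrite mul1r invf_le1 ?ltr0n // ler1n.
Qed.

Lemma Hsum_cofinal (A : R) : exists n0, forall n, (n0 <= n)%N -> A <= Hsum R n.
Proof.
pose k := (Num.trunc (2 * Num.max A 0)).+1; exists (2 ^ k)%N => n kn.
apply: le_trans (Hsum_mono _ kn); apply: le_trans (Hsum_double k).
have : 2 * Num.max A 0 < k%:R.
  by have /trunc_itv/andP[] : 0 <= 2 * Num.max A 0 by rewrite mulr_ge0 // le_max lexx orbT.
have : A <= Num.max A 0 by rewrite le_max lexx.
lra.
Qed.

(* With [t^2 <= Hsum N < (t+1)^2] the window starts at [t^3]: this is beyond
   [Hsum n / eps], while [Hsum N <= 2 sqrt(t^3) exp(2 S)] forces [S] to be large. *)
Lemma prime_window (B eps : R) (K : nat) : 0 < eps ->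
  exists n0, forall n, (n0 <= n)%N -> exists m,
    [/\ (0 < m)%N, (K <= m)%N, Hsum R n / m%:R <= eps
      & B <= harm (ind R [pred j | [&& prime j, m < j & j + 3 <= n]%N]) n].
Proof.
move=> eps0.
(* A t above 7 / eps makes [Hsum n] / t^3 small, and a t above 4 exp(4 B) contradicts a prime sum
   below B. *)
pose t0 := (Num.trunc (7 / eps) + Num.trunc (4 * expR (4 * B)) + K + 2)%N.
have [t0a t0b t0c t0d] : [/\ (Num.trunc (7 / eps) < t0)%N,
    (Num.trunc (4 * expR (4 * B)) < t0)%N, (K <= t0)%N & (2 <= t0)%N].
  by rewrite /t0; split; lia.
have [n1 Hn1] := Hsum_cofinal (t0 ^ 2)%N%:R.
(* N = n - 3 because the primes wanted satisfy p + 3 <= n. *)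
exists (n1 + 3)%N => n nn; pose N := (n - 3)%N.
have HN : (t0 ^ 2)%N%:R <= Hsum R N by apply: Hn1; rewrite /N; lia.
have exP : exists t, (t ^ 2)%N%:R <= Hsum R N by exists t0.
have bP t : (t ^ 2)%N%:R <= Hsum R N -> (t <= N)%N.
  move=> h; have := le_trans h (Hsum_le_nat N); rewrite ler_nat; nia.
case: (ex_maxnP exP bP) => t tH tmax.
have tt0 : (t0 <= t)%N by apply: tmax.
have Ht : Hsum R N < (t.+1 ^ 2)%N%:R.
  by rewrite ltNge; apply/negP => /tmax; rewrite ltnn.
exists (t ^ 3)%N.
have t1 : (2 <= t)%N by apply: leq_trans tt0.
have m0 : (0 < t ^ 3)%N by rewrite expn_gt0; lia.
have tr : 2 <= t%:R :> R by rewrite ler_nat.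
split=> //.
- rewrite (@leq_trans t) //; first exact: leq_trans tt0.
  by rewrite -{1}(expn1 t) leq_exp2l //.
- have e7 : 7 / eps < t%:R.
    apply: (@lt_le_trans _ _ (Num.trunc (7 / eps)).+1%:R).
      by have /trunc_itv/andP[] : 0 <= 7 / eps by rewrite divr_ge0 // ltW.
    by rewrite ler_nat; apply: leq_trans tt0.
  have Hn : Hsum R n <= Hsum R N + 3.
    by rewrite (_ : n = N + 3)%N; [apply: Hsum_addn | rewrite /N; lia].
  rewrite ler_pdivrMr ?ltr0n //.
  move: Ht; rewrite !natrX -natr1; set x := t%:R => Ht.
  rewrite ltr_pdivrMr // in e7.
  (* (t + 1)^2 + 3 <= 7 t^2, since t >= 2. *)
  apply: (@le_trans _ _ (7 * x ^+ 2)); first by nra.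
  have -> : eps * x ^+ 3 = (eps * x) * x ^+ 2 by ring.
  by rewrite ler_wpM2r ?sqr_ge0 // mulrC ltW.
set m := (t ^ 3)%N; set P := [pred j | _].
apply: (@le_trans _ _ (prime_sum m N)); last first.
  have P0 j : 0 <= ind R P j / j%:R by rewrite divr_ge0 ?ind_ge0.
  case: (leqP m N) => mN; last by rewrite /prime_sum big_geq ?ltnS ?(ltnW mN) // harm_ge0 //; apply: ind_ge0.
  have Nn : (N <= n)%N by rewrite /N; lia.
  rewrite /harm (@big_cat_nat _ _ _ m.+1) ?ltnS ?(leq_trans mN) //=.
  rewrite (@big_cat_nat _ _ _ N.+1 m.+1) ?ltnS //= addrCA -[leLHS]addr0; apply: lerD.
    rewrite /prime_sum !big_nat; apply: ler_sum => j /andP[j1 j2].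
    rewrite ler_wpM2r ?invr_ge0 // /ind /P /= j1.
    have -> : (j + 3 <= n)%N by rewrite /N in j2; lia.
    by rewrite !andbT.
  by rewrite addr_ge0 // sumr_ge0.
(* Otherwise t^2 <= [Hsum N] <= 2 t^(3/2) exp(2 S), so t <= 4 exp(4 S) < 4 exp(4 B). *)
rewrite leNgt; apply/negP => SB.
have := Hsum_le_euler_prod N; have := euler_prod_ratio N m0; have := euler_prod_le m0.
have := euler_prod_gt0 m; rewrite -/m; set x := euler_prod m; set S := prime_sum m N => x0 xm h1 h2.
have h3 : Hsum R N <= x * expR (2 * S) by apply: le_trans h1.
have e0 := expR_gt0 (2 * S).
have e4 : expR (2 * S) ^+ 2 < expR (4 * B).
  by rewrite expr2 -expRD ltr_expR; rewrite /S; lra.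
have h4 : t%:R ^+ 4 <= 4 * t%:R ^+ 3 * expR (2 * S) ^+ 2 :> R.
  apply: (@le_trans _ _ ((x * expR (2 * S)) ^+ 2)).
    have hx : t%:R ^+ 2 <= x * expR (2 * S) by rewrite -natrX (le_trans tH).
    rewrite (exprM _ 2 2) lerXn2r // nnegrE ?exprn_ge0 ?ler0n //.
    by rewrite mulr_ge0 // ltW.
  by rewrite exprMn ler_wpM2r ?sqr_ge0 // (le_trans xm) // natrX.
have h5 : t%:R <= 4 * expR (2 * S) ^+ 2.
  have t3 : 0 < t%:R ^+ 3 :> R by rewrite exprn_gt0 //; lra.
  rewrite -(ler_pM2r t3) -exprS; move: h4; lra.
have : 4 * expR (4 * B) < t%:R.
  apply: (@lt_le_trans _ _ (Num.trunc (4 * expR (4 * B))).+1%:R).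
    by have /trunc_itv/andP[] : 0 <= 4 * expR (4 * B) by rewrite mulr_ge0 // expR_ge0.
  by rewrite ler_nat; apply: leq_trans tt0.
lra.
Qed.

End Primes.

(** * Uniform bound on non-derangements and the equivalence *)

Local Open Scope classical_set_scope.
Local Open Scope ring_scope.

Lemma card_Alt_overgroup n (G : {group 'S_n}) : (1 < n)%N ->
  ('Alt_('I_n))%g \subset G -> (n`! <= 2 * #|G|)%N.
Proof.
move=> n1 AG; rewrite -{1}(card_ord n) -card_Alt ?card_ord // leq_mul2l /=.
exact: subset_leq_card.
Qed.

(** [n0] and [K] depend on [eps] alone, which is what the limit over i requires. *)
Lemma non_derangements_small (R : realType) (eps : R) : 0 < eps ->
  exists n0 K : nat, forall (n : nat) (G : {group 'S_n}) (Om : finType)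
      (to : {action [subg G] &-> Om}),
    (n0 <= n)%N -> ('Alt_('I_n))%g \subset G -> primitive_act to -> (3 <= #|Om|)%N ->
    (forall k, (0 < k <= K)%N -> ~ is_ksubset_act to k) ->
    #|(~: derangements to)%SET|%:R <= eps * #|{: [subg G]}|%:R.
Proof.
move=> eps0.
(* 288 = 36 times 8, so that for K <= k <= n / 2 at most a proportion eps / 8 of the permutations
   preserve some k-set. *)
have [K HK] := Hsum_cofinal (288 / eps).
have e8 : 0 < eps / 8 by rewrite divr_gt0.
(* Both terms of the lone cycle bound become at most eps / 8; primes above K + 3 exceed 3 and force
   block sizes of at least K. *)
have [n1 Hn1] := prime_window (8 / eps) (K + 3) e8.
exists (n1 + 5)%N, K => n G Om to nn AG prim Om3 nk.
have n4 : (4 < n)%N by lia.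
have [|m [m0 mK mH mB]] := Hn1 n; first by lia.
set P := [pred j | _] in mB.
have hP p : P p -> [/\ prime p, (3 < p)%N & (p + 3 <= n)%N].
  by case/and3P=> pp mp pn; split=> //; lia.
have hPK p : P p -> (K <= p)%N by case/and3P=> pp mp pn; lia.
have [x0 _] : exists x, x \in [set: Om]%SET.
  by apply/set0Pn; rewrite -card_gt0 cardsT; apply: leq_trans Om3.
set D := (~: derangements to)%SET.
pose E := [set sgval w | w in D]%SET.
have cE : #|D| = #|E| by rewrite card_imset //; apply: val_inj.
have F0 : 0 < (n`!)%:R :> R by rewrite ltr0n fact_gt0.
(* |G| >= n! / 2 turns eps / 2 of n! into eps of |G|. *)
suff main : #|D|%:R <= eps / 2 * (n`!)%:R.
  apply: (le_trans main); rewrite card_subg_type.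
  have := card_Alt_overgroup (leq_trans (isT : (1 < 5)%N) n4) AG.
  rewrite -(ler_nat R) natrM => h.
  have := ler_wpM2l (ltW (divr_gt0 eps0 (ltr0Sn R 1))) h.
  by rewrite mulrA divfK //; lra.
have fix_le k : (K <= k)%N -> (k.*2 <= n)%N -> #|fixes_kset 'I_n k|%:R <= eps / 8 * (n`!)%:R :> R.
  move=> Kk k2; have := @card_fixes_kset 'I_n R k; rewrite card_ord => /(_ k2).
  have := HK k Kk; rewrite ler_pdivrMr // => h1 h2.
  have H0 : 0 < Hsum R k by apply: lt_le_trans (HK k Kk); rewrite divr_gt0.
  rewrite -(ler_pM2r H0); apply: (le_trans h2).
  have : 36 * (n`!)%:R <= (Hsum R k * eps / 8) * (n`!)%:R by rewrite ler_pM2r //; lra.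
  by move/le_trans; apply; rewrite le_eqVlt; apply/orP; left; apply/eqP; ring.
have S0 : 0 < harm (ind R P) n by apply: lt_le_trans mB; rewrite divr_gt0.
have lone_le : #|(~: lone_cycle 'I_n P)%SET|%:R <= eps / 4 * (n`!)%:R :> R.
  have := @card_not_lone_cycle 'I_n R P m m0; rewrite card_ord => /(_ _ S0) h.
  apply: le_trans (h _) _; first by move=> j /and3P[].
  rewrite mulrC ler_pM2r //.
  have : (harm (ind R P) n)^-1 <= eps / 8.
    by rewrite -(invrK (eps / 8)) lef_pV2 ?posrE ?invr_gt0 // invf_div.
  lra.
have [[k [k0 k2 kset kfix]]|nl|[a [a2 [p Pp pa] afix]]] := stab_trichotomy AG n4 prim Om3 x0 hP.
- have Kk : (K <= k)%N by rewrite leqNgt; apply/negP=> kK; apply: (nk k) => //; rewrite k0 ltnW.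
  have : (#|D| <= #|fixes_kset 'I_n k|)%N.
    rewrite cE subset_leq_card //; apply/fintype.subsetP=> _ /imsetP[w wD ->].
    by apply: kfix; move: wD; rewrite inE.
  by rewrite -(ler_nat R) => /le_trans; apply; apply: (le_trans (fix_le k Kk k2)); nra.
- have : (#|D| <= #|(~: lone_cycle 'I_n P)%SET|)%N.
    rewrite cE subset_leq_card //; apply/fintype.subsetP=> _ /imsetP[w wD ->].
    by rewrite inE; apply: nl; move: wD; rewrite inE.
  by rewrite -(ler_nat R) => /le_trans; apply; apply: (le_trans lone_le); nra.
have : (#|D| <= #|(~: lone_cycle 'I_n P)%SET| + #|fixes_kset 'I_n a|)%N.
  apply: leq_trans (leq_card_setU _ _); rewrite cE subset_leq_card //.
  apply/fintype.subsetP=> _ /imsetP[w wD ->]; rewrite inE finset.in_setC.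
  case: (boolP (sgval w \in lone_cycle 'I_n P)) => //= wl.
  by apply: afix wl; move: wD; rewrite inE.
have Ka : (K <= a)%N by apply: leq_trans (hPK _ Pp) pa.
rewrite -(ler_nat R) natrD => /le_trans; apply.
by apply: (le_trans (lerD lone_le (fix_le a Ka a2))); nra.
Qed.

Theorem theorem3p3 (R : realType) (n : nat -> nat)
    (G : forall i : nat, {group 'S_(n i)})
    (Omega : nat -> finType)
    (to : forall i : nat, {action [subg (G i)] &-> Omega i})
    (hG : forall i : nat,
        G i = ('Sym_('I_(n i)))%g :> {set 'S_(n i)} \/
        G i = ('Alt_('I_(n i)))%g :> {set 'S_(n i)})
    (hprim : forall i : nat, primitive_act (to i))
    (hcard : forall i : nat, (3 <= #|Omega i|)%N)
    (hn : n i @[i --> \oo] --> \oo) :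
  [<-> derangement_proportion (to i) R @[i --> \oo] --> (1 : R);
       ~ (exists k : nat, (0 < k)%N /\
           forall N : nat, exists i : nat, (N <= i)%N /\ is_ksubset_act (to i) k);
       act_rank (to i) @[i --> \oo] --> \oo].
Proof.
have AG i : ('Alt_('I_(n i)))%g \subset G i.
  by case: (hG i) => ->; rewrite ?finset.subsetT ?fintype.subxx.
have cG i : 0 < #|{: [subg (G i)]}|%:R :> R.
  by rewrite ltr0n card_subg_type cardG_gt0.
have dE i : 1 - derangement_proportion (to i) R =
    #|(~: derangements (to i))%SET|%:R / #|{: [subg (G i)]}|%:R.
  have h := cG i; apply: (mulIf (lt0r_neq0 h)).
  rewrite divfK ?lt0r_neq0 // mulrBl mul1r divfK ?lt0r_neq0 //.
  by rewrite -(cardsC (derangements (to i))) natrD addrC addrA addNr add0r.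
have dle i : 0 <= 1 - derangement_proportion (to i) R.
  by rewrite dE divr_ge0.
have h13 : derangement_proportion (to i) R @[i --> \oo] --> (1 : R) ->
    act_rank (to i) @[i --> \oo] --> \oo.
  move/cvgrPdist_lt => hd; apply/cvgnyPge => A.
  have A0 : 0 < (A.+1%:R : R)^-1 by rewrite invr_gt0.
  have := hd _ A0; apply: filterS => i; rewrite ger0_norm // dE.
  rewrite ltr_pdivrMr // => h; rewrite leqNgt; apply/negP => rA.
  have [tr _] := andP (hprim i).
  have := card_non_derangements tr; rewrite -(ler_nat R) natrM => h2.
  have : #|(~: derangements (to i))%SET|%:R * A.+1%:R < #|{: [subg (G i)]}|%:R :> R.
    by rewrite mulrC in h; rewrite -ltr_pdivlMr.
  rewrite ltNge; apply/negP/negPn; apply: (le_trans h2).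
  by rewrite ler_wpM2l // ler_nat ltnW // ltnW.
have h32 : act_rank (to i) @[i --> \oo] --> \oo ->
    ~ (exists k : nat, (0 < k)%N /\
         forall N : nat, exists i : nat, (N <= i)%N /\ is_ksubset_act (to i) k).
  move/cvgnyPge => hr [k [k0 hk]].
  have [N1 _ HN1] := hr k.+2; have [N2 _ HN2] := (cvgnyPge _).1 hn 5%N.
  have [i [iN ki]] := hk (maxn N1 N2).
  have h1 := HN1 i (leq_trans (leq_maxl _ _) iN); have h2 := HN2 i (leq_trans (leq_maxr _ _) iN).
  by have := ksubset_act_rank (AG i) h2 ki; rewrite leqNgt h1.
have h21 : ~ (exists k : nat, (0 < k)%N /\
         forall N : nat, exists i : nat, (N <= i)%N /\ is_ksubset_act (to i) k) ->
    derangement_proportion (to i) R @[i --> \oo] --> (1 : R).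
  move=> hk; apply/cvgrPdist_le => eps eps0.
  have [n0 [K HK]] := non_derangements_small eps0.
  (* By (2) each k from 1 to K occurs for finitely many i only; the largest of the K thresholds
     serves for all of them. *)
  have [N1 HN1] : exists N, forall i, (N <= i)%N -> forall k, (0 < k <= K)%N -> ~ is_ksubset_act (to i) k.
    elim: K {HK} => [|K [N IH]]; first by exists 0%N => i _ k; lia.
    have [N' HN'] : exists N', forall i, (N' <= i)%N -> ~ is_ksubset_act (to i) K.+1.
      apply: contrapT => hN; apply: hk; exists K.+1; split=> // N'.
      apply: contrapT => hN'; apply: hN; exists N' => i iN ki; apply: hN'.
      by exists i.
    exists (maxn N N') => i iN k /andP[k0]; rewrite leq_eqVlt => /orP[/eqP ->|kK].
      by apply: HN'; apply: leq_trans iN; apply: leq_maxr.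
    by apply: (IH i) => //; [apply: leq_trans iN; apply: leq_maxl | rewrite k0].
  have [N2 _ HN2] := (cvgnyPge _).1 hn n0.
  exists (maxn N1 N2) => // i /= iN; rewrite ger0_norm // dE ler_pdivrMr //.
  apply: HK => //; first exact: HN2 (leq_trans (leq_maxr _ _) iN).
  by apply: HN1; apply: leq_trans iN; apply: leq_maxl.
tfae.
- by move/h13/h32.
- by move/h21/h13.
- by move/h32/h21.
Qed.
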